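(* Let $(\mathrm{RAN}_t)_{t\ge 0}$ be the random Apollonian network process and let $\mathcal{L}_t$ be the number of vertices in a longest (simple) path in $\mathrm{RAN}_t$. Then there exists a fixed (deterministic) $\delta<1$ such that $\mathcal{L}_t<t^{\delta}$ eventually (for large $t$).
   Context: Random Apollonian network: start with a triangle embedded in the plane. At each step, choose a bounded face uniformly at random (given the past), add a new vertex inside that face and join it to the three vertices on the face; in this way one face is destroyed and three new bounded faces are created. After $t$ steps one obtains a random triangulated plane graph $\mathrm{RAN}_t$ with $t+3$ vertices, $3t+3$ edges, $2t+1$ bounded faces and one unbounded face. A sequence of events $\{A_k, k\in\mathbb{N}\}$ occurs eventually (for large $k$) if there exists an almost surely finite random variable $N$ such that $A_k$ occurs for all $k\ge N$. *)

(* Defs.v *)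
From HB Require Import structures.
From mathcomp Require Import all_boot all_order all_algebra finmap.
From mathcomp Require Import all_classical all_reals all_analysis.
From mathcomp Require Import measurable_realfun.

Set Implicit Arguments.
Unset Strict Implicit.
Unset Printing Implicit Defensive.

Import Order.TTheory GRing.Theory Num.Theory.

(* Triangulated plane graphs are encoded combinatorially (up to homeomorphism
   of the plane). A bounded face is the triple of its boundary vertices in
   counterclockwise order. The unbounded face, (0, 2, 1) throughout, is never
   subdivided and is not stored. *)
Definition face : Type := (nat * nat * nat)%type.

Record plane_graph : Type := PlaneGraph {
  vertices : {fset nat};
  edges : {fset {fset nat}};
  bounded_faces : {fset face}
}.

Definition adjacent (G : plane_graph) : rel nat :=
  fun u v => [fset u; v]%fset \in edges G.

Definition triangle : plane_graph := {|
  vertices := [fset 0; 1; 2]%fset;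
  edges := [fset [fset 0; 1]; [fset 1; 2]; [fset 0; 2]]%fset;
  bounded_faces := [fset (0, 1, 2)]%fset
|}.

(* The new vertex is labelled #|` vertices G|: in the graphs built from
   [triangle], the vertices are 0, ..., n - 1, so that this label is fresh. *)
Definition subdivide (G : plane_graph) (f : face) : plane_graph :=
  let: (a, b, c) := f in
  let v := #|` vertices G| in
  {| vertices := (v |` vertices G)%fset;
     edges := (edges G `|` [fset [fset a; v]; [fset b; v]; [fset c; v]])%fset;
     bounded_faces := (bounded_faces G `\ f
                        `|` [fset (a, b, v); (b, c, v); (c, a, v)])%fset |}.

Definition simple_path (G : plane_graph) (p : seq nat) : bool :=
  [&& uniq p, all (fun v => v \in vertices G) p & sorted (adjacent G) p].

Definition longest_path (G : plane_graph) : nat :=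
  \max_(k < #|` vertices G|.+1 |
        `[< exists p : seq nat, simple_path G p /\ size p = k >]) k.

Local Open Scope classical_set_scope.
Local Open Scope ring_scope.

Record RAN_process (R : realType) (d : measure_display)
    (Omega : measurableType d) (P : probability Omega R) : Type := RANProcess {
  RAN :> nat -> Omega -> plane_graph;
  chosen_face : nat -> Omega -> face;
  RAN_measurable : forall (t : nat) (G : plane_graph),
    measurable [set w | RAN t w = G];
  chosen_face_measurable : forall (t : nat) (f : face),
    measurable [set w | chosen_face t w = f];
  RAN_start : forall w : Omega, RAN 0%N w = triangle;
  chosen_face_bounded : forall (t : nat) (w : Omega),
    chosen_face t w \in bounded_faces (RAN t w);
  RAN_step : forall (t : nat) (w : Omega),
    RAN t.+1 w = subdivide (RAN t w) (chosen_face t w);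
  (* P (chosen_face t = f | RAN 0 = g 0, ..., RAN t = g t) is
     1 / #|` bounded_faces (g t)|, multiplied out so that histories of
     probability zero need no special treatment. *)
  chosen_face_uniform : forall (t : nat) (g : nat -> plane_graph) (f : face),
    f \in bounded_faces (g t) ->
    let past := [set w | forall i : nat, (i <= t)%N -> RAN i w = g i] in
    (P (past `&` [set w | chosen_face t w = f]) =
      (#|` bounded_faces (g t)|%:R^-1)%:E * P past)%E
}.

Definition occurs_eventually (R : realType) (d : measure_display)
    (Omega : measurableType d) (P : probability Omega R)
    (A : nat -> set Omega) : Prop :=
  exists N : Omega -> \bar R,
    [/\ measurable_fun setT N,
        {ae P, forall w, N w \is a fin_num} &
        forall (w : Omega) (k : nat), (N w <= k%:R%:E)%E -> A k w].

(* Main.v *)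
Require Import Defs.
From HB Require Import structures.
From mathcomp Require Import all_boot all_order all_algebra finmap.
From mathcomp Require Import all_classical all_reals all_analysis.
From mathcomp Require Import measurable_realfun.
From mathcomp Require Import ring lra zify.

Set Implicit Arguments.
Unset Strict Implicit.
Unset Printing Implicit Defensive.

Import Order.TTheory GRing.Theory Num.Theory.
Local Open Scope classical_set_scope.
Local Open Scope ring_scope.

(** Why longest paths are short.  Cut the plane into regions: a region is a
    bounded face together with everything drawn inside it later on.  The
    first four vertices inserted into a region split it into nine faces, each
    of which starts a new region of its own; iterating, one gets a tree in
    which every full node has nine children.  The three corners and the four
    inner vertices of a full region form a set of seven vertices that separates
    the nine subregions from each other, and deleting seven vertices leaves at
    most eight segments of a path.  Hence a simple path misses one of the nine
    subregions of every full region ([missed_subregion]), whichever region one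
    looks at.

    If the sizes of the nine subregions were comparable, a constant fraction of
    the vertices would be lost at every level of the tree and a power of t would
    be gained.  To avoid a union bound over the possible families of missed
    subregions, let [l] be the number of faces of a region, [l_j] those of its
    subregions, and let [potential] be the function with

      S = (1 - (l_1 * ... * l_9) / (2 * l ^ 9)) * (32 + S_1 + ... + S_9).

    The Cauchy-Schwarz inequality and the missing subregion show that the number
    v of path vertices in a region satisfies v ^ 2 <= l * S ([visits_sqr_le]).
    This bound is deterministic and holds for all paths at once, so that only
    the mean of S is needed.

    For the mean, the faces of the nine subregions behave as a Polya urn with
    nine colours, and given the sizes the nine subtrees are independent copies
    of the process.  Therefore S_j may be replaced by its mean given l_j
    ([forest_potential_le]).  If that mean is at most 14 * l_j ^ a - 5 for some
    a < 1, then concavity gives l_1 ^ a + ... + l_9 ^ a <= 9 ^ (1 - a) * l ^ a,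
    while the urn satisfies E (l_1 * ... * l_9) >= p * l ^ 9 for a constant
    p > 0 ([balance_lower]).  The first factor of S thus has mean at most
    1 - p / 2, and as soon as a is so close to 1 that
    9 ^ (1 - a) * (1 - p / 2) <= 1 the bound reproduces itself
    ([growth_sum_potential_le]).

    So the square of the longest path has mean O(t ^ (1 + a)).  Markov's
    inequality along t = 2 ^ j ([tail_prob_le]), the Borel-Cantelli lemma, and
    the fact that paths persist when the graph grows give the theorem with
    exponent (3 + a) / 4. *)

(** * Trees of blocks and their growth *)

(** [Open] nodes are regions with fewer than four inserted vertices, [Full] nodes
    have received four and carry their nine subregions.  The labels [A] and [B]
    allow the same type for bare shapes and for regions of a graph. *)
Inductive block_tree (A B : Type) : Type :=
  | Open of A
  | Full of B & seq (block_tree A B).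

HB.instance Definition _ (A B : Type) := gen_eqMixin (block_tree A B).

Lemma block_tree_ind_mem (A B : Type) (Q : block_tree A B -> Prop) :
  (forall a, Q (Open B a)) ->
  (forall b ts, (forall t, t \in ts -> Q t) -> Q (Full b ts)) ->
  forall t, Q t.
Proof.
move=> Qopen Qfull; fix IH 1; case=> [a|b ts]; first exact: Qopen.
apply: Qfull; elim: ts => [|t ts IHts] u; first by clear IH.
by rewrite inE => /predU1P[->|/IHts] //; exact: IH.
Qed.

(** An open shape only remembers its number of inserted vertices. *)
Definition block_shape : Type := block_tree nat unit.

Definition empty_shape : block_shape := Open unit 0%N.

Fixpoint leaves (t : block_shape) : nat :=
  match t with
  | Open k => k.*2.+1
  | Full _ ts => sumn (map leaves ts)
  end.

(** All ways to apply [g] to exactly one entry of a list. *)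
Definition forest_step (T : Type) (g : T -> seq T) : seq T -> seq (seq T) :=
  fix step ts :=
    if ts is t :: ts' then
      [seq t' :: ts' | t' <- g t] ++ [seq t :: u | u <- step ts']
    else [::].

(** The list of shapes obtained by subdividing one of the faces, one entry per
    face, hence with repetitions: a uniform choice in [grow t] is a uniform
    choice of a face. *)
Fixpoint grow (t : block_shape) : seq block_shape :=
  match t with
  | Open k => nseq k.*2.+1
      (if k == 3 then Full tt (nseq 9 empty_shape) else Open unit k.+1)
  | Full b ts => map (Full b) (forest_step grow ts)
  end.

(** The sum of [H] over all [n]-step growths of [x], counted with multiplicity.
    For [grow] this is the expectation of [H] after [n] steps, up to the factor
    [rising (leaves x) n]. *)
Fixpoint growth_sum (R : realType) (T : Type) (g : T -> seq T) (n : nat)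
    (H : T -> R) (x : T) : R :=
  if n is m.+1 then \sum_(y <- g x) growth_sum g m H y else H x.

(** The product of the nine shares of the total.  It bounds the smallest share
    from below and, unlike a minimum, has an explicit mean in the Polya urn. *)
Definition balance (R : realType) (ls : seq nat) : R :=
  (\prod_(l <- ls) l)%N%:R / (sumn ls)%:R ^+ 9.

(** The constants: an open region has at most three inserted vertices, and
    9 = 3 ^ 2; a full region has four vertices outside its subregions, and
    16 = 4 ^ 2 = 32 / 2, where the summand 1 / 2 is paid by half of the faces of
    the missed subregion. *)
Fixpoint potential (R : realType) (t : block_shape) : R :=
  match t with
  | Open _ => 9
  | Full _ ts => (1 - 2^-1 * balance R (map leaves ts)) *
                 (32 + \sum_(x <- map (potential R) ts) x)
  end.

(** The product l (l + 2) ... (l + 2n - 2): every step destroys one face and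
    creates three, so this counts the [n]-step growths of a tree with [l] faces. *)
Fixpoint rising (l n : nat) : nat :=
  if n is m.+1 then (l * rising l.+2 m)%N else 1%N.

(** * Sums over growths *)

(** Two functions need to be compared only on what can be reached in exactly [n]
    steps; [I k] describes what is reachable at time [k]. *)
Lemma growth_sum_le (R : realType) (T : eqType) (g : T -> seq T)
    (I : nat -> T -> Prop) :
  (forall k x y, I k x -> y \in g x -> I k.+1 y) ->
  forall n k x (H H' : T -> R), I k x ->
  (forall y, I (k + n)%N y -> H y <= H' y) ->
  growth_sum g n H x <= growth_sum g n H' x.
Proof.
move=> Istep; elim=> [|n IHn] k x H H' Ix HH' /=; first by apply: HH'; rewrite addn0.
rewrite big_seq [leRHS]big_seq; apply: ler_sum => y gy.
apply: (IHn k.+1); first exact: Istep gy.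
by move=> z; rewrite addSnnS; apply: HH'.
Qed.

Lemma growth_sum_eq (R : realType) (T : eqType) (g : T -> seq T)
    (I : nat -> T -> Prop) :
  (forall k x y, I k x -> y \in g x -> I k.+1 y) ->
  forall n k x (H H' : T -> R), I k x ->
  (forall y, I (k + n)%N y -> H y = H' y) ->
  growth_sum g n H x = growth_sum g n H' x.
Proof.
move=> Istep n k x H H' Ix HH'; apply/eqP; rewrite eq_le.
by apply/andP; split; apply: (growth_sum_le Istep Ix) => y /HH' ->.
Qed.

Lemma growth_sum_ext (R : realType) (T : Type) (g : T -> seq T) n (H H' : T -> R) x :
  H =1 H' -> growth_sum g n H x = growth_sum g n H' x.
Proof.
move=> HH'; elim: n x => [|n IHn] x /=; first exact: HH'.
by apply: eq_bigr => y _.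
Qed.

Lemma growth_sum_mono (R : realType) (T : Type) (g : T -> seq T) n (H H' : T -> R) x :
  (forall y, H y <= H' y) -> growth_sum g n H x <= growth_sum g n H' x.
Proof.
move=> HH'; elim: n x => [|n IHn] x /=; first exact: HH'.
exact: ler_sum.
Qed.

Lemma growth_sum_sum (R : realType) (T I : Type) (g : T -> seq T) n
    (s : seq I) (H : I -> T -> R) x :
  growth_sum g n (fun y => \sum_(i <- s) H i y) x =
  \sum_(i <- s) growth_sum g n (H i) x.
Proof.
elim: n x => [|n IHn] x //=.
by rewrite exchange_big /=; apply: eq_bigr => y _; rewrite IHn.
Qed.

Lemma growth_sumZ (R : realType) (T : Type) (g : T -> seq T) n (c : R) H x :
  growth_sum g n (fun y => c * H y) x = c * growth_sum g n H x.
Proof.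
elim: n x => [|n IHn] x //=.
by rewrite mulr_sumr; apply: eq_bigr => y _; rewrite IHn.
Qed.

Lemma growth_sumD (R : realType) (T : Type) (g : T -> seq T) n (H H' : T -> R) x :
  growth_sum g n (fun y => H y + H' y) x =
  growth_sum g n H x + growth_sum g n H' x.
Proof.
elim: n x => [|n IHn] x //=.
by rewrite -big_split /=; apply: eq_bigr => y _; rewrite IHn.
Qed.

(** The Leibniz rule.  A growth of a forest of [n] steps is an interleaving of a
    growth of [i] steps of its first tree with one of [n - i] steps of the other
    trees.  This is the conditional independence of the trees given their
    sizes. *)
Lemma growth_sum_forest (R : realType) (T : Type) (g : T -> seq T) n
    (H : seq T -> R) t ts :
  growth_sum (forest_step g) n H (t :: ts) =
  \sum_(i < n.+1) 'C(n, i)%:R *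
    growth_sum g i (fun t' =>
      growth_sum (forest_step g) (n - i) (fun u => H (t' :: u)) ts) t.
Proof.
elim: n t ts => [|n IHn] t ts.
  by rewrite big_ord_recl big_ord0 /= bin0 mul1r addr0.
pose D i j := growth_sum g i (fun t' =>
      growth_sum (forest_step g) j (fun u => H (t' :: u)) ts) t.
transitivity (\sum_(i < n.+1) 'C(n, i)%:R * D i.+1 (n - i)%N +
              \sum_(i < n.+1) 'C(n, i)%:R * D i (n - i).+1); last first.
  have -> : \sum_(i < n.+1) 'C(n, i)%:R * D i (n - i).+1 =
      D 0%N n.+1 + \sum_(i < n) 'C(n, i.+1)%:R * D i.+1 (n - i)%N.
    rewrite big_ord_recl bin0 mul1r /= subn0; congr (_ + _).
    by apply: eq_bigr => i _; rewrite /bump /= add1n subnSK.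
  rewrite [RHS]big_ord_recl bin0 mul1r /= -/(D 0%N n.+1) addrCA; congr (_ + _).
  transitivity (\sum_(i < n.+1) ('C(n, i)%:R * D i.+1 (n - i)%N +
                                 'C(n, i.+1)%:R * D i.+1 (n - i)%N)).
    rewrite big_split /=; congr (_ + _).
    by rewrite big_ord_recr /= bin_small // mul0r addr0.
  by apply: eq_bigr => i _; rewrite /bump /= add1n subSS binS addnC natrD mulrDl.
rewrite [LHS]/= big_cat /= !big_map; congr (_ + _).
  under eq_bigr => y _ do rewrite IHn.
  rewrite exchange_big /=; apply: eq_bigr => i _.
  by rewrite -mulr_sumr.
under eq_bigr => y _ do rewrite IHn.
rewrite exchange_big /=; apply: eq_bigr => i _.
by rewrite -mulr_sumr /D /= growth_sum_sum.
Qed.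

(** * The mean of the potential *)

Lemma size_forest_step (g : block_shape -> seq block_shape) ts :
  (forall t, t \in ts -> size (g t) = leaves t) ->
  size (forest_step g ts) = sumn (map leaves ts).
Proof.
elim: ts => //= t ts IHts gts; rewrite size_cat !size_map gts ?mem_head//.
by rewrite IHts // => u uts; apply: gts; rewrite inE uts orbT.
Qed.

Lemma size_grow t : size (grow t) = leaves t.
Proof.
elim/block_tree_ind_mem: t => [k|b ts IHts] /=; first by rewrite size_nseq.
by rewrite size_map size_forest_step.
Qed.

Lemma leaves_forest_step (g : block_shape -> seq block_shape) ts u :
  (forall t, t \in ts -> forall t', t' \in g t -> leaves t' = (leaves t).+2) ->
  u \in forest_step g ts ->
  size u = size ts /\ sumn (map leaves u) = (sumn (map leaves ts)).+2.
Proof.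
elim: ts u => //= t ts IHts u gts; rewrite mem_cat => /orP[]/mapP[v vg ->] /=.
  by rewrite (gts t (mem_head _ _) v) // !addSn.
have [|-> ->] := IHts v _ vg; last by rewrite !addnS.
by move=> x xts; apply: gts; rewrite inE xts orbT.
Qed.

Lemma leaves_grow t t' : t' \in grow t -> leaves t' = (leaves t).+2.
Proof.
elim/block_tree_ind_mem: t t' => [k|b ts IHts] t' /=.
  rewrite inE mem_nseq => t'k.
  have -> : t' = if k == 3 then Full tt (nseq 9 empty_shape) else Open unit k.+1.
    by case/orP: t'k => [/eqP|/andP[_ /eqP]].
  by case: eqP => [->|].
by move=> /mapP[u uts ->] /=; have [] := leaves_forest_step IHts uts.
Qed.

Lemma growth_sum1 (R : realType) (T : eqType) (g : T -> seq T) (m : T -> nat) n x :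
  (forall y, size (g y) = m y) ->
  (forall y z, z \in g y -> m z = (m y).+2) ->
  growth_sum g n (fun=> 1 : R) x = (rising (m x) n)%:R.
Proof.
move=> gm mg; elim: n x => [|n IHn] x //=.
under eq_big_seq => y yg do rewrite IHn (mg _ _ yg).
by rewrite big_const_seq count_predT iter_addr_0 gm natrM mulr_natl.
Qed.

Lemma growth_sum_leaves (R : realType) n (h : nat -> R) t :
  growth_sum grow n (fun t => h (leaves t)) t =
  h (leaves t + n.*2)%N * (rising (leaves t) n)%:R.
Proof.
rewrite -(growth_sum1 R n t size_grow leaves_grow) -growth_sumZ.
apply: (@growth_sum_eq _ _ _ (fun k y => leaves y = leaves t + k.*2)%N _ n 0%N).
- by move=> k x y lx /leaves_grow ->; rewrite lx doubleS !addnS.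
- by rewrite addn0.
- by move=> y ->; rewrite mulr1.
Qed.

Lemma growth_sum_Full (R : realType) n (H : block_shape -> R) b ts :
  growth_sum grow n H (Full b ts) =
  growth_sum (forest_step grow) n (fun u => H (Full b u)) ts.
Proof.
elim: n ts => [|n IHn] ts //=.
by rewrite big_map; apply: eq_bigr => u _; rewrite IHn.
Qed.

Lemma growth_sum_forest1 (R : realType) n ts :
  growth_sum (forest_step grow) n (fun=> 1 : R) ts =
  (rising (sumn (map leaves ts)) n)%:R.
Proof.
apply: (@growth_sum1 _ _ _ (fun u => sumn (map leaves u))) => [u|u v].
  by rewrite size_forest_step // => t _; exact: size_grow.
by case/leaves_forest_step => // t _ t'; exact: leaves_grow.
Qed.

(** Every step multiplies the sum of the product of the sizes by a constant,
    because a tree is chosen with weight its size [l] and then [l] becomes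
    [l + 2]. *)
Lemma prod_leaves_forest_step ts :
  (\sum_(u <- forest_step grow ts) \prod_(t <- u) leaves t =
   (\prod_(t <- ts) leaves t) * (sumn (map leaves ts) + (size ts).*2))%N.
Proof.
elim: ts => [|t ts IHts]; first by rewrite /= !big_nil muln0.
rewrite [forest_step _ _]/= big_cat !big_map /=.
have -> : (\sum_(t' <- grow t) \prod_(s <- t' :: ts) leaves s =
    leaves t * ((leaves t).+2 * \prod_(s <- ts) leaves s))%N.
  transitivity (\sum_(t' <- grow t) (leaves t).+2 * \prod_(s <- ts) leaves s)%N.
    by apply: eq_big_seq => t' t't; rewrite big_cons (leaves_grow t't).
  by rewrite big_const_seq count_predT size_grow iter_addn_0 mulnC.
have -> : (\sum_(u <- forest_step grow ts) \prod_(s <- t :: u) leaves s =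
    leaves t * ((\prod_(s <- ts) leaves s) *
                (sumn (map leaves ts) + (size ts).*2)))%N.
  by rewrite -IHts big_distrr /=; apply: eq_bigr => u _; rewrite big_cons.
rewrite big_cons; set P := bigop _ _ _; nia.
Qed.

Lemma growth_sum_prod_leaves (R : realType) n ts :
  growth_sum (forest_step grow) n
    (fun u => (\prod_(t <- u) leaves t)%N%:R : R) ts =
  ((\prod_(t <- ts) leaves t) *
    rising (sumn (map leaves ts) + (size ts).*2) n)%N%:R.
Proof.
elim: n ts => [|n IHn] ts; first by rewrite /= muln1.
rewrite [LHS]/=; under eq_big_seq => u uts.
  rewrite IHn.
  have [|-> ->] := leaves_forest_step _ uts; first by move=> ? _ ?; exact: leaves_grow.
  over.
rewrite -natr_sum -big_distrl /= prod_leaves_forest_step.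
by rewrite -mulnA.
Qed.

Lemma rising_add l a b : rising l (a + b) = (rising l a * rising (l + a.*2) b)%N.
Proof.
elim: a l => [|a IHa] l /=; first by rewrite addn0 mul1n.
by rewrite IHa doubleS !addSn !addnS mulnA.
Qed.

Lemma rising_ge l n : (l ^ n <= rising l n)%N.
Proof.
elim: n l => [|n IHn] l //=; rewrite expnS leq_mul2l; apply/orP; right.
apply: leq_trans (IHn _).
by case: n {IHn} => // n; rewrite leq_exp2r // leqW.
Qed.

Lemma growth_sum_nil (R : realType) (T : Type) (g : T -> seq T) n
    (H : seq T -> R) :
  H [::] = 0 -> growth_sum (forest_step g) n H [::] = 0.
Proof. by case: n => [|n] H0 //=; rewrite big_nil. Qed.

(** By conditional independence, the potentials of the trees of a forest may be
    replaced by bounds [h] for their means, even in the presence of a factor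
    [G >= 0] that depends on all the sizes.  This is why the first factor of
    [potential] is a function of sizes alone. *)
Lemma forest_potential_le (R : realType) (h : nat -> R) n :
  (forall i, (i <= n)%N ->
     growth_sum grow i (potential R) empty_shape <=
     growth_sum grow i (fun t => h (leaves t)) empty_shape) ->
  forall k (G : seq nat -> R), (forall ls, size ls = k -> 0 <= G ls) ->
  forall m, (m <= n)%N ->
  growth_sum (forest_step grow) m
    (fun u => G (map leaves u) * \sum_(t <- u) potential R t)
    (nseq k empty_shape) <=
  growth_sum (forest_step grow) m
    (fun u => G (map leaves u) * \sum_(t <- u) h (leaves t))
    (nseq k empty_shape).
Proof.
move=> tree_le; elim=> [|k IHk] G G_ge0 m mn.
  by rewrite !growth_sum_nil // big_nil mulr0.
rewrite -[nseq _ _]/(empty_shape :: nseq k empty_shape) !growth_sum_forest.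
apply: ler_sum => i _; apply: ler_wpM2l => //.
have im : (i <= m)%N by rewrite -ltnS.
set F := nseq k empty_shape; set j := (m - i)%N.
(* K and B are the contributions of the other trees given that the first tree
   has l leaves. *)
pose K l := growth_sum (forest_step grow) j (fun u => G (l :: map leaves u)) F.
pose B l := growth_sum (forest_step grow) j
  (fun u => G (l :: map leaves u) * \sum_(t <- u) h (leaves t)) F.
have split_head (w : block_shape -> R) t : growth_sum (forest_step grow) j
    (fun u => G (map leaves (t :: u)) * \sum_(x <- t :: u) w x) F =
    w t * K (leaves t) + growth_sum (forest_step grow) j
      (fun u => G (leaves t :: map leaves u) * \sum_(x <- u) w x) F.
  rewrite -growth_sumZ -growth_sumD; apply: growth_sum_ext => u /=.
  by rewrite big_cons mulrDr mulrC.
have G'_ge0 l ls : size ls = k -> 0 <= G (l :: ls).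
  by move=> szls; apply: G_ge0; rewrite /= szls.
have K_ge0 l : 0 <= K l.
  rewrite -(mul0r (growth_sum (forest_step grow) j (fun=> 1) F)) -growth_sumZ.
  apply: (@growth_sum_le _ _ _ (fun _ u => size u = k) _ _ 0%N).
  - move=> _ x y szx /leaves_forest_step [|-> //].
    by move=> t _ t'; exact: leaves_grow.
  - by rewrite size_nseq.
  - by move=> u szu; rewrite mul0r G'_ge0 // size_map.
apply: (@le_trans _ _ (growth_sum grow i
    (fun t => potential R t * K (leaves t) + B (leaves t)) empty_shape)).
  apply: growth_sum_mono => t; rewrite split_head lerD2l.
  apply: (IHk (fun ls => G (leaves t :: ls))).
    exact: G'_ge0.
  exact: leq_trans (leq_subr _ _) mn.
have -> : (fun t' => growth_sum (forest_step grow) j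
    (fun u => G (map leaves (t' :: u)) * \sum_(t <- t' :: u) h (leaves t)) F) =
    (fun t => h (leaves t) * K (leaves t) + B (leaves t)).
  by apply/funext => t; rewrite split_head.
(* After i steps the first tree has 2i+1 leaves, so K and B are constants. *)
have constants (w : block_shape -> R) :
    growth_sum grow i (fun t => w t * K (leaves t) + B (leaves t)) empty_shape =
    K i.*2.+1 * growth_sum grow i w empty_shape +
    growth_sum grow i (fun=> B i.*2.+1) empty_shape.
  rewrite -growth_sumZ -growth_sumD.
  apply: (@growth_sum_eq _ _ _ (fun k y => leaves y = k.*2.+1)%N _ i 0%N) => //.
    by move=> k' x y lx /leaves_grow ->; rewrite lx doubleS.
  by move=> y ->; rewrite mulrC.
by rewrite !constants lerD2r; apply: ler_wpM2l => //; apply: tree_le; exact: leq_trans mn.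
Qed.

(** Young's inequality for the exponents [a^-1] and [(1 - a)^-1]: a concave
    function lies below its tangent at 1. *)
Lemma powR_le_tangent (R : realType) (a x : R) :
  0 < a < 1 -> 0 <= x -> x `^ a <= a * x + (1 - a).
Proof.
move=> /andP[a0 a1] x0; have b0 : 0 < 1 - a by rewrite subr_gt0.
have /(_ _ _) := @conjugate_powR R (x `^ a) 1 a^-1 (1 - a)^-1 (powR_ge0 _ _) ler01.
rewrite !invr_gt0 !invrK => /(_ a0 b0 (subrKC _ _)).
rewrite mulr1 -powRrM divff ?gt_eqF // powRr1 // powR1 mul1r.
by rewrite mulrC.
Qed.

(** Jensen's inequality for nine terms, from the tangent at their mean. *)
Lemma sum_powR_le (R : realType) (a : R) (ls : seq nat) : 0 < a < 1 ->
  size ls = 9 -> (0 < sumn ls)%N ->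
  \sum_(l <- ls) l%:R `^ a <= 9 `^ (1 - a) * (sumn ls)%:R `^ a.
Proof.
move=> a01 sz9 L0; set L : R := (sumn ls)%:R; pose c := L / 9.
have Lpos : 0 < L by rewrite ltr0n.
have c0 : 0 < c by rewrite divr_gt0.
have -> : \sum_(l <- ls) l%:R `^ a =
    c `^ a * \sum_(l <- ls) (l%:R / c) `^ a.
  rewrite mulr_sumr; apply: eq_bigr => l _.
  by rewrite -powRM ?divr_ge0 ?(ltW c0) // mulrC divfK // gt_eqF.
have le9 : \sum_(l <- ls) (l%:R / c) `^ a <= 9.
  apply: (@le_trans _ _ (\sum_(l <- ls) (a / c * l%:R + (1 - a)))).
    apply: ler_sum => l _; apply: (le_trans (powR_le_tangent a01 _)).
      by rewrite divr_ge0 ?(ltW c0).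
    by rewrite lerD2r mulrA mulrAC.
  rewrite big_split /= -mulr_sumr big_const_seq count_predT iter_addr_0 sz9.
  have -> : \sum_(l <- ls) l%:R = L by rewrite /L sumnE natr_sum.
  have -> : a / c * L = 9 * a.
    by rewrite /c; field; rewrite gt_eqF.
  by rewrite -mulr_natl; lra.
apply: le_trans (_ : c `^ a * 9 <= _); first by apply: ler_wpM2l => //; exact: powR_ge0.
rewrite le_eqVlt; apply/orP; left; apply/eqP.
have -> : L `^ a = (9 * c) `^ a by congr (_ `^ a); rewrite /c mulrC divfK // pnatr_eq0.
rewrite powRM ?(ltW c0) // mulrA -powRD; last by rewrite pnatr_eq0 implybT.
by rewrite subrK powRr1 // mulrC.
Qed.

(** The first four steps have 1, 3, 5 and 7 faces to choose from, and all
    1 * 3 * 5 * 7 = 105 outcomes have the same shape. *)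
Lemma growth_sum_empty_shape (R : realType) n (H : block_shape -> R) :
  growth_sum grow n.+4 H empty_shape =
  105 * growth_sum grow n H (Full tt (nseq 9 empty_shape)).
Proof. by rewrite /= !(big_cons, big_nil); ring. Qed.

Lemma prod_le_sumn_exp (ls : seq nat) :
  (\prod_(l <- ls) l <= sumn ls ^ size ls)%N.
Proof.
elim: ls => [|l ls IHls]; first by rewrite big_nil.
rewrite big_cons /= expnS leq_mul ?leq_addr // (leq_trans IHls) //.
by case: (size ls) => // n; rewrite leq_exp2r // leq_addl.
Qed.

Lemma balance_ge0 (R : realType) ls : 0 <= balance R ls.
Proof. by rewrite divr_ge0 ?exprn_ge0. Qed.

Lemma balance_le1 (R : realType) ls : size ls = 9 -> balance R ls <= 1.
Proof.
move=> sz; have := prod_le_sumn_exp ls; rewrite sz /balance -natrX.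
case: (sumn ls ^ 9)%N => [|m] le; first by rewrite invr0 mulr0.
by rewrite ler_pdivrMr ?ltr0n // mul1r ler_nat.
Qed.

(** The mean balance is bounded below uniformly in [n].  The quotient
    [rising 27 n / rising 9 n] telescopes to a product of nine factors, each at
    least [9 + 2 n], over [rising 9 9]. *)
Lemma balance_lower (R : realType) n :
  (rising 9 n)%:R / (rising 9 9)%:R <=
  (rising 27 n)%:R / (9 + n.*2)%:R ^+ 9 :> R.
Proof.
have r9 : (0 < rising 9 9)%N by apply: leq_trans (rising_ge 9 9); rewrite expn_gt0.
rewrite ler_pdivrMr ?ltr0n // mulrAC ler_pdivlMr; last by rewrite exprn_gt0 // ltr0n.
rewrite -natrX -!natrM ler_nat.
have -> : (rising 27 n * rising 9 9 = rising 9 9 * rising 27 n)%N by rewrite mulnC.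
have <- : (rising 9 (9 + n) = rising 9 9 * rising 27 n)%N := rising_add 9 9 n.
by rewrite (addnC 9 n) rising_add leq_mul2l rising_ge orbT.
Qed.

(** The constant 14 makes the bound hold for open shapes, where it must be at
    least 9.  The constant 5 absorbs the summand 32 of [potential]: the nine
    subtrees contribute - 45, and half of 45 - 32 exceeds 5. *)
Lemma growth_sum_potential_le (R : realType) (a : R) : 0 < a < 1 ->
  9 `^ (1 - a) * (1 - 2^-1 / (rising 9 9)%:R) <= 1 ->
  forall n, growth_sum grow n (potential R) empty_shape <=
    (14 * n.*2.+1%:R `^ a - 5) * (rising 1 n)%:R.
Proof.
move=> a01 drift; elim/ltn_ind => n IHn.
case: (ltnP n 4) => [n4|n4].
  have ge1 : 1 <= n.*2.+1%:R `^ a :> R.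
    have /andP[a0 _] := a01.
    rewrite -[leLHS](_ : 1 `^ a = 1); last by rewrite powR1.
    apply: ge0_ler_powR; rewrite ?nnegrE ?(ltW a0) //.
    by rewrite ler1n.
  apply: (@le_trans _ _ (9 * (rising 1 n)%:R)); last by apply: ler_wpM2r => //; lra.
  by case: n n4 {IHn ge1} => [|[|[|[|]]]] // _ /=; rewrite ?(big_cons, big_nil) /=; lra.
have {n4} [m nE] : exists m, n = m.+4 by exists (n - 4)%N; lia.
subst n; pose h l : R := 14 * l%:R `^ a - 5.
have IHh i : (i <= m)%N -> growth_sum grow i (potential R) empty_shape <=
    growth_sum grow i (fun t => h (leaves t)) empty_shape.
  move=> im; rewrite growth_sum_leaves /h /=; apply: IHn; lia.
rewrite growth_sum_empty_shape growth_sum_Full.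
set fs := forest_step grow; set F := nseq 9 empty_shape.
pose theta (u : seq nat) : R := 1 - 2^-1 * balance R u.
set L := (9 + m.*2)%N.
(* A forest grown from nine empty shapes still has nine trees, and L leaves. *)
have reach (H H' : seq block_shape -> R) :
    (forall u, size u = 9 -> sumn (map leaves u) = L -> H u <= H' u) ->
    growth_sum fs m H F <= growth_sum fs m H' F.
  move=> HH'; apply: (@growth_sum_le _ _ _
    (fun k u => size u = 9 /\ sumn (map leaves u) = 9 + k.*2)%N _ m 0%N) => //.
  - move=> k u v [szu lu] /leaves_forest_step [|-> ->].
      by move=> t _ t'; exact: leaves_grow.
    by rewrite szu lu doubleS !addnS.
  - by move=> u [szu lu]; apply: HH'.
have theta_ge (ls : seq nat) : size ls = 9 -> 2^-1 <= theta ls <= 1.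
  by move=> /(balance_le1 R); have := balance_ge0 R ls; rewrite /theta; lra.
have -> : growth_sum fs m (fun u => potential R (Full tt u)) F =
    growth_sum fs m (fun u => 32 * theta (map leaves u)) F +
    growth_sum fs m (fun u => theta (map leaves u) * \sum_(t <- u) potential R t) F.
  rewrite -growth_sumD; apply: growth_sum_ext => u /=.
  by rewrite big_map mulrDr mulrC.
have /(_ theta) R1 := forest_potential_le IHh (k := 9).
have {}R1 := R1 (fun ls sz => le_trans _ (proj1 (andP (theta_ge ls sz)))) m (leqnn m).
apply: (@le_trans _ _ (105 * growth_sum fs m (fun u => 14 * 9 `^ (1 - a) * L%:R `^ a *
   theta (map leaves u) + (-5) * 1) F)).
  apply: ler_wpM2l => //; apply: (@le_trans _ _
    (growth_sum fs m (fun u => 32 * theta (map leaves u)) F +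
     growth_sum fs m (fun u => theta (map leaves u) * \sum_(t <- u) h (leaves t)) F)).
    by rewrite lerD2l; apply: R1; rewrite invr_ge0.
  rewrite -growth_sumD; apply: reach => u szu lu.
  have := @sum_powR_le R a (map leaves u) a01; rewrite size_map lu => /(_ szu isT).
  rewrite big_map; set X := \sum_(j <- u) _; set Y := 9 `^ _ * _ => XY.
  have -> : \sum_(t <- u) h (leaves t) = 14 * X - 45.
    rewrite /h big_split /= -mulr_sumr big_const_seq count_predT iter_addr_0 szu.
    by congr (_ + _); rewrite -mulr_natl; lra.
  have := theta_ge (map leaves u); rewrite size_map => /(_ szu).
  set th := theta _ => /andP[th1 th2]; rewrite -!(mulrA 14) -/Y.
  have : 0 <= th * (Y - X) by apply: mulr_ge0; lra.
  by nra.
rewrite growth_sumD !growth_sumZ growth_sum_forest1.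
have -> : growth_sum fs m (fun u => theta (map leaves u)) F =
    (rising 9 m)%:R - 2^-1 * ((rising 27 m)%:R / L%:R ^+ 9).
  rewrite -[in LHS](growth_sum_ext _ _ _
    (H := fun u => 1 + (- 2^-1) * balance R (map leaves u))); last first.
    by move=> u; rewrite /theta mulNr.
  rewrite growth_sumD growth_sumZ growth_sum_forest1 mulNr; congr (_ - _ * _).
  have prodF := growth_sum_prod_leaves R m F.
  transitivity (L%:R ^- 9 * growth_sum fs m (fun u => (\prod_(t <- u) leaves t)%N%:R : R) F).
    rewrite -growth_sumZ; apply/eqP; rewrite eq_le.
    by apply/andP; split; apply: reach => u szu lu;
      rewrite /balance lu big_map mulrC.
  have F1 : (\prod_(t <- F) leaves t)%N = 1%N.
    by rewrite big1_seq // => t /andP[_]; rewrite mem_nseq => /andP[_ /eqP ->].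
  by rewrite prodF F1 mul1n mulrC.
have -> : (rising 1 m.+4 = 105 * rising 9 m)%N by rewrite /=; lia.
have := balance_lower R m; rewrite -/L; set q := _ / _ ^+ 9 => bl.
have LE : m.+4.*2.+1 = L by rewrite /L; lia.
rewrite LE natrM; set r : R := (rising 9 m)%:R in bl *.
have r0 : 0 <= r by rewrite ler0n.
set A := 14 * 9 `^ _ * _.
have A0 : 0 <= A by rewrite !mulr_ge0 ?powR_ge0.
have key : A * (r - 2^-1 * q) <= 14 * L%:R `^ a * r.
  apply: (@le_trans _ _ (A * (r * (1 - 2^-1 / (rising 9 9)%:R)))).
    by apply: ler_wpM2l => //; lra.
  have := ler_wpM2l (mulr_ge0 (mulr_ge0 (ler0n R 14) (powR_ge0 L%:R a)) r0) drift.
  by rewrite /A; lra.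
by lra.
Qed.

(** * Regions of a triangulation *)

Definition corners (f : face) : seq nat :=
  let: (a, b, c) := f in [:: a; b; c].

Definition subfaces (f : face) (v : nat) : seq face :=
  let: (a, b, c) := f in [:: (a, b, v); (b, c, v); (c, a, v)].

(** The labels are the face that the region started from, the vertices inserted
    before the region became full and, for open regions, the present faces. *)
Definition region : Type :=
  block_tree (face * seq nat * seq face) (face * seq nat).

Definition empty_region (f : face) : region := Open _ (f, [::], [:: f]).

Definition boundary (r : region) : seq nat :=
  match r with
  | Open (f0, _, _) => corners f0
  | Full (f0, _) _ => corners f0
  end.

Fixpoint inside (r : region) : seq nat :=
  match r with
  | Open (_, vs, _) => vs
  | Full (_, vs) rs => vs ++ flatten (map inside rs)
  end.

Fixpoint region_faces (r : region) : seq face :=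
  match r with
  | Open (_, _, fs) => fs
  | Full _ rs => flatten (map region_faces rs)
  end.

(** Adding a vertex [v] in the face [f].  A region in which [f] does not occur is
    left as it is ([insert_notin]). *)
Fixpoint insert (f : face) (v : nat) (r : region) : region :=
  match r with
  | Open (f0, vs, fs) =>
      if f \in fs then
        let fs' := subfaces f v ++ rem f fs in
        if size vs == 3 then Full (f0, v :: vs) (map empty_region fs')
        else Open _ (f0, v :: vs, fs')
      else r
  | Full b rs => Full b (map (insert f v) rs)
  end.

Fixpoint shape_of (r : region) : block_shape :=
  match r with
  | Open (_, vs, _) => Open _ (size vs)
  | Full _ rs => Full tt (map shape_of rs)
  end.

(** In graph terms: [Z] separates [I] from the other vertices. *)
Definition closed_up_to (G : plane_graph) (Z I : seq nat) : Prop :=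
  forall x y, x \in I -> Defs.adjacent G x y -> y \in Z ++ I.

(** The separation property of all regions, with the disjointness of subregions
    contained in the uniqueness of [inside].  The last clause of the full case is
    stated by a fold so that the recursion is structural. *)
Fixpoint well_formed (G : plane_graph) (r : region) : Prop :=
  [/\ uniq (inside r), {in inside r, forall x, x \notin boundary r},
      closed_up_to G (boundary r) (inside r) &
  match r with
  | Open (f0, vs, fs) =>
      [/\ (size vs < 4)%N, size fs = (size vs).*2.+1 &
          forall f, f \in fs -> {subset corners f <= corners f0 ++ vs}]
  | Full (f0, vs) rs =>
      [/\ size vs = 4, size rs = 9,
          forall r', r' \in rs -> {subset boundary r' <= corners f0 ++ vs} &
          foldr (fun r' => and (well_formed G r')) True rs]
  end].

Lemma foldr_andP (T : eqType) (Q : T -> Prop) (s : seq T) :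
  foldr (fun x => and (Q x)) True s <-> forall x, x \in s -> Q x.
Proof.
elim: s => //= x s [IH1 IH2]; split=> [[Qx Qs] y|Qs].
  by rewrite inE => /predU1P[->|/(IH1 Qs)].
split; first by apply: Qs; rewrite mem_head.
by apply: IH2 => y ys; apply: Qs; rewrite inE ys orbT.
Qed.

Lemma well_formed_FullP G f0 vs rs : well_formed G (Full (f0, vs) rs) <->
  [/\ uniq (inside (Full (f0, vs) rs)),
      {in inside (Full (f0, vs) rs), forall x, x \notin corners f0},
      closed_up_to G (corners f0) (inside (Full (f0, vs) rs)) &
   [/\ size vs = 4, size rs = 9,
      forall r', r' \in rs -> {subset boundary r' <= corners f0 ++ vs} &
      forall r', r' \in rs -> well_formed G r']].
Proof.
by split=> -[H1 H2 H3 [H4 H5 H6 H7]]; split=> //; split=> //;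
  move: H7; rewrite foldr_andP.
Qed.

Lemma insert_notin f v r : f \notin region_faces r -> insert f v r = r.
Proof.
elim/block_tree_ind_mem: r => [[[f0 vs] fs]|b rs IHrs] /=; first by move=> /negPf ->.
move=> frs; congr (Full b _); rewrite -[RHS]map_id; apply/eq_in_map => r rrs.
apply: IHrs => //; apply: contra frs => fr.
by apply/flattenP; exists (region_faces r) => //; exact: map_f.
Qed.

Lemma boundary_insert f v r : boundary (insert f v r) = boundary r.
Proof. by case: r => [[[f0 vs] fs]|[f0 vs] rs] //=; case: ifP => //; case: ifP. Qed.

Lemma inside_Full_mem f0 vs rs r x : r \in rs -> x \in inside r ->
  x \in inside (Full (f0, vs) rs).
Proof.
move=> rrs xr; rewrite /= mem_cat; apply/orP; right.
by apply/flattenP; exists (inside r) => //; exact: map_f.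
Qed.

(** As faces are distinct, inserting into a full region changes exactly one of
    its subregions. *)
Lemma insert_Full_split f v (rs : seq region) :
  uniq (flatten (map region_faces rs)) -> f \in flatten (map region_faces rs) ->
  exists rs1 r rs2, [/\ rs = rs1 ++ r :: rs2, f \in region_faces r,
    uniq (region_faces r), f \notin flatten (map region_faces rs1) &
    map (insert f v) rs = rs1 ++ insert f v r :: rs2].
Proof.
elim: rs => //= r rs IHrs; rewrite cat_uniq mem_cat.
case/and3P => ur /hasPn dis urs /orP[fr|frs].
  have frs : f \notin flatten (map region_faces rs).
    by apply/negP => /dis; rewrite fr.
  exists [::], r, rs; split=> //=; congr (_ :: _).
  rewrite -[RHS]map_id; apply/eq_in_map => r' r'rs; apply: insert_notin.
  apply: contra frs => fr'.
  by apply/flattenP; exists (region_faces r') => //; exact: map_f.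
have [rs1 [r' [rs2 [-> fr' ur' f1 ->]]]] := IHrs urs frs.
have fr : f \notin region_faces r by apply: dis.
exists (r :: rs1), r', rs2; split=> //=; first by rewrite mem_cat (negPf fr).
by rewrite insert_notin.
Qed.

Lemma inside_empty_regions fs : flatten (map inside (map empty_region fs)) = [::].
Proof. by elim: fs. Qed.

Lemma faces_empty_regions fs : flatten (map region_faces (map empty_region fs)) = fs.
Proof. by elim: fs => //= f fs ->. Qed.

Lemma inside_insert f v r : uniq (region_faces r) -> f \in region_faces r ->
  perm_eq (inside (insert f v r)) (v :: inside r).
Proof.
elim/block_tree_ind_mem: r => [[[f0 vs] fs]|[f0 vs] rs IHrs] /=.
  move=> _ ->; case: ifP => //= _.
  by rewrite inside_empty_regions cats0.
move=> urs frs.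
have [rs1 [r [rs2 [rsE fr ur _ ->]]]] := insert_Full_split v urs frs.
have rrs : r \in rs by rewrite rsE mem_cat mem_head orbT.
rewrite rsE !map_cat !flatten_cat /= -cat_cons.
rewrite perm_sym -cat1s -catA perm_catCA; rewrite perm_cat2l.
rewrite perm_catCA perm_cat2l catA perm_cat2r perm_sym.
exact: IHrs.
Qed.

Lemma rem_cat (T : eqType) (x : T) s1 s2 :
  rem x (s1 ++ s2) = if x \in s1 then rem x s1 ++ s2 else s1 ++ rem x s2.
Proof.
elim: s1 => //= y s1 ->; rewrite inE eq_sym; case: eqP => //= _.
by case: ifP.
Qed.

Lemma faces_insert f v r : uniq (region_faces r) -> f \in region_faces r ->
  perm_eq (region_faces (insert f v r)) (subfaces f v ++ rem f (region_faces r)).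
Proof.
elim/block_tree_ind_mem: r => [[[f0 vs] fs]|b rs IHrs].
  rewrite [insert _ _ _]/= [region_faces _]/= => _ ->; case: ifP => // _.
  by rewrite [region_faces _]/= [X in perm_eq X _]faces_empty_regions.
rewrite [insert _ _ _]/= [region_faces (Full _ _)]/= => urs frs.
have [rs1 [r [rs2 [rsE fr ur f1 rsE']]]] := insert_Full_split v urs frs.
have rrs : r \in rs by rewrite rsE mem_cat mem_head orbT.
rewrite [region_faces _]/= rsE' rsE !map_cat !flatten_cat /=.
set F1 := flatten (map region_faces rs1); set F2 := flatten (map region_faces rs2).
have -> : rem f (F1 ++ region_faces r ++ F2) = F1 ++ rem f (region_faces r) ++ F2.
  by rewrite !rem_cat (negPf f1) fr.
rewrite perm_sym perm_catCA perm_cat2l catA perm_cat2r perm_sym.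
exact: IHrs.
Qed.

(** The link between the graph and the urn: subdividing the faces of a region one
    at a time yields, in order, the list [grow] of its shape. *)
Lemma shape_insert G v r : well_formed G r -> uniq (region_faces r) ->
  map (fun f => shape_of (insert f v r)) (region_faces r) = grow (shape_of r).
Proof.
elim/block_tree_ind_mem: r => [[[f0 vs] fs]|[f0 vs] rs IHrs].
  move=> [_ _ _ [_ szfs _]] _; rewrite [RHS]/= -[_ :: _]/(nseq (size vs).*2.+1 _) -szfs.
  set X := (X in nseq _ X).
  transitivity (map (fun=> X) fs); last by elim: (fs) => //= ? ? ->.
  apply/eq_in_map => f ffs; rewrite /= ffs /X.
  case: eqP => // sz3; rewrite [LHS]/=; congr (Full tt _).
  have : size (subfaces f v ++ rem f fs) = 9.
    by rewrite size_cat size_rem // szfs sz3; case: f {ffs} => -[].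
  set s := _ ++ _ => sz9; transitivity (nseq (size s) empty_shape); last by rewrite sz9.
  by elim: (s) => //= ? ? ->.
move=> /well_formed_FullP[_ _ _ [_ _ _ wfrs]] /= urs.
have -> : [seq Full tt [seq shape_of i | i <- [seq insert f v i | i <- rs]]
     | f <- flatten [seq region_faces i | i <- rs]] =
   map (Full tt) [seq map shape_of (map (insert f v) rs) | f <- flatten (map region_faces rs)].
  by rewrite -map_comp.
congr map; elim: rs wfrs urs IHrs => //= r rs IH wfrs.
rewrite cat_uniq => /and3P[ur /hasPn dis urs] IHrs.
rewrite map_cat; congr (_ ++ _).
  rewrite -(IHrs r (mem_head _ _)) //; last by apply: wfrs; rewrite mem_head.
  rewrite -map_comp; apply/eq_in_map => f fr /=; congr (_ :: map _ _).
  rewrite -[RHS]map_id; apply/eq_in_map => r' r'rs; apply: insert_notin.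
  apply/negP => fr'; suff /dis : f \in flatten (map region_faces rs) by rewrite fr.
  by apply/flattenP; exists (region_faces r') => //; exact: map_f.
rewrite -IH // => [|r' r'rs|r' r'rs].
- rewrite -map_comp; apply/eq_in_map => f frs /=; congr (shape_of _ :: _).
  by apply: insert_notin; exact: dis.
- by apply: wfrs; rewrite inE r'rs orbT.
- by apply: IHrs; rewrite inE r'rs orbT.
Qed.

(** * Separation is preserved by subdivision *)

Lemma fset2_eq (T : choiceType) (x y a b : T) :
  ([fset x; y] == [fset a; b])%fset =
  ((x == a) && (y == b)) || ((x == b) && (y == a)).
Proof.
apply/eqP/orP => [E|[/andP[/eqP -> /eqP ->]|/andP[/eqP -> /eqP ->]]] //; last first.
  by rewrite fsetUC.
have := erefl (x \in [fset x; y]%fset); rewrite {2}E !inE eqxx /=.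
have := erefl (y \in [fset x; y]%fset); rewrite {2}E !inE eqxx orbT /=.
have := erefl (a \in [fset a; b]%fset); rewrite -{2}E !inE eqxx /=.
have := erefl (b \in [fset a; b]%fset); rewrite -{2}E !inE eqxx orbT /=.
rewrite ![a == _]eq_sym ![b == _]eq_sym.
by case: (x == a); case: (x == b); case: (y == a); case: (y == b); auto.
Qed.

Lemma adjacent_sym G x y : Defs.adjacent G x y = Defs.adjacent G y x.
Proof. by rewrite /Defs.adjacent fsetUC. Qed.

Lemma adjacent_subdivide G f x y (v := #|` vertices G|) :
  Defs.adjacent (subdivide G f) x y =
  [|| Defs.adjacent G x y, (x \in corners f) && (y == v) |
      (x == v) && (y \in corners f)].
Proof.
case: f => -[a b] c; rewrite /Defs.adjacent /= !inE !fset2_eq /= -/v.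
by case: (_ \in edges G) => //=; case: (x == v); case: (y == v);
  rewrite ?andbT ?andbF ?orbF /= ?orbT //; do ![case: (_ == _)].
Qed.

Lemma closed_subdivide_outside G f Z I (v := #|` vertices G|) :
  {in I, forall x, x \notin corners f} -> v \notin I ->
  closed_up_to G Z I -> closed_up_to (subdivide G f) Z I.
Proof.
move=> If vI cl x y xI; rewrite adjacent_subdivide (negPf (If _ xI)) /=.
case/orP => [/(cl _ _ xI)//|/andP[/eqP xv _]].
by rewrite /v -xv xI in vI.
Qed.

Lemma closed_subdivide_inside G f Z I I' (v := #|` vertices G|) :
  (forall x y, Defs.adjacent G x y -> x != v) ->
  {subset corners f <= Z ++ I} -> I' =i v :: I ->
  closed_up_to G Z I -> closed_up_to (subdivide G f) Z I'.
Proof.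
move=> fresh fZI I'E cl x y; rewrite I'E adjacent_subdivide -/v => xI.
have up z : z \in Z ++ I -> z \in Z ++ I'.
  by rewrite !mem_cat I'E inE => /orP[->|->] //; rewrite !orbT.
case/or3P => [xy|/andP[_ /eqP ->]|/andP[_ /fZI]]; last exact: up.
- move: xI; rewrite inE (negPf (fresh _ _ xy)) /= => xI.
  exact/up/cl/xy.
- by rewrite mem_cat I'E mem_head orbT.
Qed.

Lemma face_corners G r f : well_formed G r -> f \in region_faces r ->
  {subset corners f <= boundary r ++ inside r}.
Proof.
elim/block_tree_ind_mem: r f => [[[f0 vs] fs]|[f0 vs] rs IHrs] f.
  by move=> [_ _ _ [_ _ +]] => /[apply].
move=> /well_formed_FullP[_ _ _ [_ _ bd wfrs]] /= /flattenP[_ /mapP[r rrs ->]] fr.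
move=> x /(IHrs r rrs f (wfrs _ rrs) fr); rewrite mem_cat => /orP[/(bd _ rrs)|xr].
  by rewrite !mem_cat => /orP[->|->] //; rewrite orbT.
by rewrite mem_cat (inside_Full_mem f0 vs rrs xr) orbT.
Qed.

(** A new vertex has its neighbours among the corners of the face it subdivides,
    so a region that contains none of these corners sees no new edge. *)
Lemma well_formed_subdivide_outside G f r (v := #|` vertices G|) :
  {in inside r, forall x, x \notin corners f} -> v \notin inside r ->
  well_formed G r -> well_formed (subdivide G f) r.
Proof.
elim/block_tree_ind_mem: r => [[[f0 vs] fs]|[f0 vs] rs IHrs] If vI.
  by move=> [H1 H2 H3 H4]; split=> //; exact: closed_subdivide_outside.
move=> /well_formed_FullP[H1 H2 H3 [H4 H5 H6 H7]].
apply/well_formed_FullP; split=> //; first exact: closed_subdivide_outside.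
split=> // r rrs; apply: IHrs => //; last exact: H7.
  by move=> x xr; apply: If; exact: inside_Full_mem xr.
by apply: contra vI; exact: inside_Full_mem.
Qed.

Lemma well_formed_empty_region G f : well_formed G (empty_region f).
Proof. by split=> //; split=> // g; rewrite inE => /eqP -> x; rewrite cats0. Qed.

Lemma subfaces_corners f v g : g \in subfaces f v ->
  {subset corners g <= v :: corners f}.
Proof.
case: f => -[a b] c; rewrite !inE => /or3P[]/eqP -> x; rewrite !inE.
- by case/or3P => /eqP ->; rewrite eqxx ?orbT.
- by case/or3P => /eqP ->; rewrite eqxx ?orbT.
- by case/or3P => /eqP ->; rewrite eqxx ?orbT.
Qed.

(** The subregion that contains [f] is handled by induction.  The others are
    disjoint from the corners of [f], because these lie in the first one or among
    the seven separating vertices. *)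
Lemma well_formed_insert G f r (v := #|` vertices G|) :
  (forall x y, Defs.adjacent G x y -> x != v) ->
  v \notin boundary r ++ inside r ->
  uniq (region_faces r) -> f \in region_faces r ->
  well_formed G r -> well_formed (subdivide G f) (insert f v r).
Proof.
move=> fresh.
have common r' : v \notin boundary r' ++ inside r' -> uniq (region_faces r') ->
    f \in region_faces r' -> well_formed G r' ->
    [/\ uniq (inside (insert f v r')),
        {in inside (insert f v r'), forall x, x \notin boundary (insert f v r')} &
        closed_up_to (subdivide G f) (boundary (insert f v r')) (inside (insert f v r'))].
  move=> vr' ur' fr' wf; have ins := inside_insert v ur' fr'.
  have fc := face_corners wf fr'.
  have [H1 H2 H3] : [/\ uniq (inside r'),
    {in inside r', forall x, x \notin boundary r'} &
    closed_up_to G (boundary r') (inside r')] by case: (r') wf => [l|b rs] [? ? ? _].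
  move: vr'; rewrite mem_cat negb_or => /andP[vb vi].
  rewrite boundary_insert; split.
  - by rewrite (perm_uniq ins) /= vi.
  - by move=> x; rewrite (perm_mem ins) inE => /predU1P[->|/H2].
  - exact: closed_subdivide_inside (perm_mem ins) H3.
elim/block_tree_ind_mem: r => [[[f0 vs] fs]|[f0 vs] rs IHrs] vr ur fr wf.
  have := common _ vr ur fr wf; move: wf => [_ _ _ [szvs szfs fsc]].
  have {}fr : f \in fs := fr.
  rewrite /= fr; set fs' := subfaces f v ++ rem f fs.
  have szfs' : size fs' = (size vs).+1.*2.+1.
    by rewrite size_cat size_rem // szfs; case: (f) => -[].
  have fs'c g : g \in fs' -> {subset corners g <= corners f0 ++ v :: vs}.
    have up x : x \in corners f0 ++ vs -> x \in corners f0 ++ v :: vs.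
      by rewrite !mem_cat inE => /orP[->|->] //; rewrite !orbT.
    rewrite mem_cat => /orP[/subfaces_corners gf x /gf|/mem_rem/fsc gc x /gc/up //].
    by rewrite inE => /predU1P[->|/(fsc _ fr)/up //]; rewrite mem_cat mem_head orbT.
  case: eqP => [sz3|sz3].
    move=> [H1 H2 H3]; apply/well_formed_FullP; split=> //; split=> //=.
    - by rewrite sz3.
    - by rewrite size_map szfs' sz3.
    - by move=> _ /mapP[g gfs' ->]; exact: fs'c.
    - by move=> _ /mapP[g _ ->]; exact: well_formed_empty_region.
  by move=> [H1 H2 H3]; split=> //; split=> //=; lia.
have [U D C] := common _ vr ur fr wf.
move: (wf) => /well_formed_FullP[H1 H2 H3 [H4 H5 H6 H7]].
have [rs1 [r [rs2 [rsE fr' ur' _ rsE']]]] := insert_Full_split v ur fr.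
have rrs : r \in rs by rewrite rsE mem_cat mem_head orbT.
apply/well_formed_FullP; split=> //; split=> //; first by rewrite size_map.
  by move=> _ /mapP[r' r'rs ->]; rewrite boundary_insert; exact: H6.
have in_sub r' : r' \in rs -> v \notin inside r'.
  move=> r'rs; move: vr; rewrite mem_cat negb_or => /andP[_]; apply: contra.
  exact: inside_Full_mem.
have wf_other r' : r' \in rs1 ++ rs2 -> well_formed (subdivide G f) r'.
  move=> r'12; have r'rs : r' \in rs.
    by move: r'12; rewrite rsE !mem_cat inE => /orP[->|->] //; rewrite !orbT.
  apply: well_formed_subdivide_outside; [|exact: in_sub|exact: H7].
  move=> x xr'; apply/negP => /(face_corners (H7 _ rrs) fr').
  rewrite mem_cat => /orP[/(H6 _ rrs)|xr].
    rewrite mem_cat => /orP[|xvs].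
      by apply/negP; apply: H2; exact: inside_Full_mem xr'.
    have xF : x \in flatten (map inside rs).
      by apply/flattenP; exists (inside r') => //; exact: map_f.
    move: H1; rewrite /= cat_uniq => /and3P[_ /hasPn/(_ _ xF) + _].
    by rewrite /= xvs.
  move: H1; rewrite /= cat_uniq => /and3P[_ _].
  rewrite rsE map_cat flatten_cat /= cat_uniq has_cat cat_uniq negb_or.
  case/and3P => _ /andP[/hasPn/(_ x xr) /= x1 _] /and3P[_ /hasPn x2 _].
  move: r'12; rewrite mem_cat => /orP[r'1|r'2].
    move/negP: x1; apply; apply/flattenP; exists (inside r') => //; exact: map_f.
  have /x2/negP : x \in flatten (map inside rs2).
    by apply/flattenP; exists (inside r') => //; exact: map_f.
  by apply.
move=> r'; rewrite rsE' mem_cat inE orbCA -mem_cat.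
case/predU1P => [->|]; last exact: wf_other.
apply: IHrs => //; last exact: H7.
rewrite mem_cat negb_or in_sub // andbT; apply/negP => /(H6 _ rrs) vb.
move: vr; rewrite /= catA mem_cat negb_or => /andP[/negP]; by [].
Qed.

(** * A path misses one subregion of nine *)

(** Deleting the vertices in [Z] cuts the path into at most [count Z p + 1]
    segments, on each of which [kappa] is constant. *)
Lemma size_undup_segments (T K : eqType) (Z : pred T) (kappa : T -> K)
    (e : rel T) (p : seq T) :
  (forall x y, e x y -> ~~ Z x -> ~~ Z y -> kappa x = kappa y) ->
  sorted e p ->
  (size (undup (map kappa [seq x <- p | ~~ Z x])) <= (count Z p).+1)%N.
Proof.
move=> ek; elim: {p}_.+1 {-2}p (ltnSn (size p)) => // n IHn [|x p] //= szp ep.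
have sp : sorted e p := path_sorted ep.
case: (boolP (Z x)) => Zx /=; first by rewrite add1n leqW // IHn.
rewrite add0n; case: p szp ep sp => [|y q] //= szp /andP[exy eq] sp.
case: (boolP (Z y)) => Zy /=.
  rewrite add1n.
  apply: leq_trans (_ : (size (undup (map kappa [seq x <- q | ~~ Z x]))).+1 <= _)%N.
    by case: ifP => // _; exact: leqW.
  by rewrite ltnS; apply: IHn; [exact: ltnW|exact: path_sorted eq].
rewrite (ek _ _ exy Zx Zy) mem_head.
by have := IHn (y :: q) szp sp; rewrite /= Zy /= (negPf Zy).
Qed.

Lemma find_flatten (T : eqType) (S : Type) (g : S -> seq T) (s : seq S) r0 i x :
  uniq (flatten (map g s)) -> (i < size s)%N -> x \in g (nth r0 s i) ->
  find (fun r => x \in g r) s = i.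
Proof.
elim: s i => //= r s IHs [|i] /=; first by move=> _ _ ->.
rewrite cat_uniq ltnS => /and3P[_ /hasPn dis us] is_ xg.
rewrite (IHs i) //; case: ifP => // xr.
suff /dis : x \in flatten (map g s) by rewrite /= xr.
elim: (s) (i) is_ xg => //= r' s' IH [|j] /= js xg; rewrite mem_cat ?xg //.
by rewrite (IH j) ?orbT.
Qed.

(** The seven vertices [corners f0 ++ vs] leave at most eight segments, and each of
    them stays in one subregion or outside of all. *)
Lemma missed_subregion G f0 vs (rs : seq region) p :
  well_formed G (Full (f0, vs) rs) -> uniq p -> sorted (Defs.adjacent G) p ->
  exists rs1 r rs2, rs = rs1 ++ r :: rs2 /\ {in inside r, forall x, x \notin p}.
Proof.
move=> /well_formed_FullP[H1 H2 H3 [H4 H5 H6 H7]] up sp.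
(* kappa x is the index of the subregion that contains x, and 9 outside. *)
pose Z := corners f0 ++ vs; pose kappa x := find (fun r => x \in inside r) rs.
move: (H1); rewrite /= cat_uniq => /and3P[_ /hasPn dis uflat].
have kappaE i x : (i < 9)%N -> x \in inside (nth (empty_region f0) rs i) -> kappa x = i.
  by move=> i9; apply: find_flatten; rewrite ?H5.
have kappaP r x y : r \in rs -> x \in inside r -> y \in inside r -> kappa x = kappa y.
  move=> /(nthP (empty_region f0))[i]; rewrite H5 => i9 <- xr yr.
  by rewrite (kappaE i) // (kappaE i).
have kappa_out x : ~~ has (fun r => x \in inside r) rs -> kappa x = size rs.
  by move/hasNfind.
have adjP r x y : r \in rs -> x \in inside r -> Defs.adjacent G x y ->
    y \notin Z -> y \in inside r.
  move=> rrs xr xy yZ.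
  have cl : closed_up_to G (boundary r) (inside r).
    by case: (r) (H7 _ rrs) => [l|b rs'] [].
  move: (cl _ _ xr xy); rewrite mem_cat => /orP[/(H6 _ rrs)|//].
  by rewrite (negPf yZ).
have seg : (size (undup (map kappa [seq x <- p | x \notin Z])) <= 8)%N.
  apply: leq_trans (size_undup_segments (Z := mem Z) _ sp) _.
    move=> x y xy xZ yZ.
    case: (boolP (has (fun r => x \in inside r) rs)) => [/hasP[r rrs xr]|nx].
      by apply: (kappaP r) => //; exact: adjP xy yZ.
    case: (boolP (has (fun r => y \in inside r) rs)) => [/hasP[r rrs yr]|ny].
      apply: (kappaP r) => //; rewrite adjacent_sym in xy; exact: adjP xy xZ.
    by rewrite !kappa_out.
  rewrite ltnS -size_filter.
  have sz7 : size Z = 7 by rewrite size_cat H4; case: (f0) => -[].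
  apply: (@leq_trans (size Z)); last by rewrite sz7.
  apply: uniq_leq_size; first exact: filter_uniq.
  by move=> x; rewrite mem_filter => /andP[].
have [i i9 iP] : exists2 i, (i < 9)%N &
    i \notin undup (map kappa [seq x <- p | x \notin Z]).
  apply/not_exists2P => all9; move: seg; apply/negP; rewrite -ltnNge.
  rewrite -[X in (X <= _)%N](size_iota 0 9); apply: uniq_leq_size; first exact: iota_uniq.
  move=> i; rewrite mem_iota add0n => i9; have [//|/negP] := all9 i.
  by rewrite negbK.
exists (take i rs), (nth (empty_region f0) rs i), (drop i.+1 rs); split.
  by rewrite -drop_nth ?H5 // cat_take_drop.
move=> x xr; apply: contra iP => xp; rewrite mem_undup; apply/mapP.
have rrs : nth (empty_region f0) rs i \in rs by rewrite mem_nth // H5.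
exists x; last by rewrite (kappaE i).
rewrite mem_filter xp andbT /= mem_cat negb_or H2 /=; last exact: inside_Full_mem xr.
apply: dis; apply/flattenP; exists (inside (nth (empty_region f0) rs i)) => //.
exact: map_f.
Qed.

(** The Cauchy-Schwarz inequality for two terms, without square roots. *)
Lemma sqr_add_le (R : realType) (x y a b c d : R) :
  0 <= a -> 0 <= b -> 0 <= c -> 0 <= d -> x ^+ 2 <= a * b -> y ^+ 2 <= c * d ->
  (x + y) ^+ 2 <= (a + c) * (b + d).
Proof.
move=> a0 b0 c0 d0 xab ycd.
suff : 2 * (x * y) <= a * d + b * c by nra.
have ad : 0 <= a * d + b * c by rewrite addr_ge0 // mulr_ge0.
apply: le_trans (ler_norm _) _; rewrite -(ger0_norm ad) -ler_sqr ?nnegrE //.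
rewrite !real_normK ?num_real //.
have : x ^+ 2 * y ^+ 2 <= (a * b) * (c * d) by apply: ler_pM; rewrite ?sqr_ge0.
have : 0 <= (a * d - b * c) ^+ 2 by exact: sqr_ge0.
by rewrite !expr2; nra.
Qed.

Lemma sqr_sum_le (R : realType) (I : Type) (s : seq I) (v a b : I -> R) (x c d : R) :
  0 <= c -> 0 <= d -> x ^+ 2 <= c * d ->
  (forall i, 0 <= a i) -> (forall i, 0 <= b i) -> (forall i, v i ^+ 2 <= a i * b i) ->
  (x + \sum_(i <- s) v i) ^+ 2 <= (c + \sum_(i <- s) a i) * (d + \sum_(i <- s) b i).
Proof.
move=> c0 d0 xcd a0 b0 vab; elim: s x c d c0 d0 xcd => [|i s IHs] x c d c0 d0 xcd.
  by rewrite !big_nil !addr0.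
rewrite !big_cons !addrA; apply: IHs; rewrite ?addr_ge0 //; exact: sqr_add_le.
Qed.

(** * Path vertices against the potential *)

Definition visits (p : seq nat) (r : region) : nat := count (mem p) (inside r).

Lemma visits_Full p b rs : visits p (Full b rs) =
  (count (mem p) b.2 + \sum_(r <- rs) visits p r)%N.
Proof.
case: b => f0 vs; rewrite /visits /= count_cat; congr (_ + _)%N.
by elim: rs => [|r rs IHrs]; rewrite ?big_nil // big_cons /= count_cat IHrs.
Qed.

Lemma leaves_shape_gt0 G r : well_formed G r -> (0 < leaves (shape_of r))%N.
Proof.
elim/block_tree_ind_mem: r => [[[f0 vs] fs] //|[f0 vs] rs IHrs].
move=> /well_formed_FullP[_ _ _ [_ szrs _ wfrs]].
case: rs IHrs wfrs szrs => //= r rs IHrs wfrs _.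
by rewrite ltn_addr // (IHrs r (mem_head _ _)) //; apply: wfrs; exact: mem_head.
Qed.

Lemma potential_ge0 (R : realType) G r :
  well_formed G r -> 0 <= potential R (shape_of r).
Proof.
elim/block_tree_ind_mem: r => [[[f0 vs] fs] //|[f0 vs] rs IHrs].
move=> /well_formed_FullP[_ _ _ [_ szrs _ wfrs]] /=.
have := @balance_le1 R (map leaves (map shape_of rs)).
rewrite !size_map => /(_ szrs) b1; apply: mulr_ge0; first by lra.
rewrite addr_ge0 // big_map big_map big_seq sumr_ge0 // => r rrs.
exact: IHrs (wfrs _ rrs).
Qed.

(** By Cauchy-Schwarz over the subregions other than the missed one [r], the
    square is at most (1/2 + l - l_r) * (32 + the sum of the potentials), and
    1/2 <= l_r / 2 with l_r / l at least the balance give the first factor of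
    [potential]. *)
Lemma visits_sqr_le (R : realType) G r p :
  well_formed G r -> uniq p -> sorted (Defs.adjacent G) p ->
  (visits p r)%:R ^+ 2 <= (leaves (shape_of r))%:R * potential R (shape_of r).
Proof.
move=> wf up sp; elim/block_tree_ind_mem: r wf => [[[f0 vs] fs]|[f0 vs] rs IHrs].
  move=> [_ _ _ [szvs _ _]] /=.
  have : (visits p (Open (face * seq nat) (f0, vs, fs)) <= 3)%N.
    by apply: leq_trans (count_size _ _) _.
  rewrite -(ler_nat R); set x := _%:R => x3.
  have x0 : 0 <= x by rewrite ler0n.
  have : 1 <= (size vs).*2.+1%:R :> R by rewrite ler1n.
  by nra.
move=> wf; have [rs1 [r [rs2 [rsE missed]]]] := missed_subregion wf up sp.
move: wf => /well_formed_FullP[_ _ _ [szvs szrs _ wfrs]].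
have rrs : r \in rs by rewrite rsE mem_cat mem_head orbT.
pose others := rs1 ++ rs2.
have others_sub r' : r' \in others -> r' \in rs.
  by rewrite rsE !mem_cat inE => /orP[->|->] //; rewrite !orbT.
pose l r : R := (leaves (shape_of r))%:R.
have sum_split (V : nmodType) (F : region -> V) :
    \sum_(x <- rs) F x = F r + \sum_(x <- others) F x.
  by rewrite rsE /others !big_cat big_cons /= addrCA.
have vis_le : (visits p (Full (f0, vs) rs))%:R <=
    4 + \sum_(x <- others) (visits p x)%:R :> R.
  rewrite visits_Full natrD natr_sum sum_split.
  have -> : visits p r = 0%N.
    by apply/eqP; rewrite -leqn0 leqNgt -has_count; apply/hasPn.
  by rewrite add0r lerD2r ler_nat (leq_trans (count_size _ _)) // szvs.
have CS : (4 + \sum_(x <- others) (visits p x)%:R) ^+ 2 <=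
    (2^-1 + \sum_(x <- others) l x) *
    (32 + \sum_(x <- others) potential R (shape_of x)).
  have restrict (F : region -> R) : \sum_(x <- others) F x =
      \sum_(x <- others) (if x \in rs then F x else 0).
    by apply: eq_big_seq => x /others_sub ->.
  rewrite (restrict (fun x => (visits p x)%:R)) (restrict l).
  rewrite (restrict (fun x => potential R (shape_of x))); apply: sqr_sum_le.
  - by rewrite invr_ge0.
  - by [].
  - by rewrite expr2; lra.
  - by move=> x; case: ifP => // _; exact: ler0n.
  - by move=> x; case: ifP => // /wfrs; exact: potential_ge0.
  - move=> x; case: ifP => [xrs|]; last by rewrite mulr0 expr0n.
    exact: IHrs (wfrs _ xrs).
apply: le_trans (_ : (4 + \sum_(x <- others) (visits p x)%:R) ^+ 2 <= _).
  by rewrite ler_sqr ?nnegrE ?addr_ge0 // sumr_ge0.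
apply: le_trans CS _; rewrite [leaves _]/= [potential _ _]/=.
set ls := map leaves _; set L := sumn ls.
have LE : L%:R = l r + \sum_(x <- others) l x.
  by rewrite -sum_split /L sumnE !big_map natr_sum.
have lr1 : 1 <= l r by rewrite ler1n (leaves_shape_gt0 (wfrs _ rrs)).
have L0 : 0 < L%:R :> R.
  by rewrite LE ltr_pwDl ?sumr_ge0 // (lt_le_trans ltr01).
have bal : balance R ls * L%:R <= l r.
  rewrite /balance -/L exprSr invfM mulrA divfK ?gt_eqF // ler_pdivrMr ?exprn_gt0 //.
  rewrite -natrX -natrM ler_nat /ls !big_map.
  have -> : (\prod_(x <- rs) leaves (shape_of x) =
      leaves (shape_of r) * \prod_(x <- others) leaves (shape_of x))%N.
    by rewrite rsE /others !big_cat big_cons /= mulnCA.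
  rewrite leq_mul2l; apply/orP; right.
  have := prod_le_sumn_exp (map (leaves \o shape_of) others).
  have szo : size others = 8.
    by move: szrs; rewrite rsE /others !size_cat /= addnS => -[].
  rewrite size_map szo big_map => /leq_trans; apply.
  rewrite leq_exp2r // -(ler_nat R) LE sumnE big_map natr_sum /l.
  by rewrite lerDr.
rewrite mulrA; apply: ler_pM.
- by rewrite addr_ge0 ?invr_ge0 // sumr_ge0.
- rewrite addr_ge0 // big_seq sumr_ge0 // => x /others_sub/wfrs; exact: potential_ge0.
- by rewrite LE in bal *; lra.
- rewrite lerD2l !big_map sum_split lerDr; exact: potential_ge0 (wfrs _ rrs).
Qed.

(** * Histories of the process *)

Definition subdivide_state (s : plane_graph * region) (f : face) : plane_graph * region :=
  (subdivide s.1 f, insert f #|` vertices s.1| s.2).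

Definition state (fs : seq face) : plane_graph * region :=
  foldl subdivide_state (triangle, empty_region (0, 1, 2)%N) fs.

Lemma state_rcons fs f : state (rcons fs f) = subdivide_state (state fs) f.
Proof. by rewrite /state -cats1 foldl_cat. Qed.

(** The sequences of faces that the process can choose. *)
Inductive history : seq face -> Prop :=
  | history_nil : history [::]
  | history_rcons fs f : history fs ->
      f \in bounded_faces (state fs).1 -> history (rcons fs f).

(** Fresh labels: the vertices are 0, ..., n - 1 and edges join vertices. *)
Definition numbered (G : plane_graph) : Prop :=
  (forall x, (x \in vertices G) = (x < #|` vertices G|)%N) /\
  (forall x y, Defs.adjacent G x y -> x \in vertices G).

(** The region describes the graph: same vertices, same bounded faces.  Faces with
    distinct corners are needed for the three new faces to be distinct. *)
Definition faithful (s : plane_graph * region) : Prop :=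
  [/\ well_formed s.1 s.2,
      forall x, (x \in vertices s.1) = (x \in boundary s.2 ++ inside s.2),
      uniq (region_faces s.2), region_faces s.2 =i bounded_faces s.1 &
      forall f, f \in region_faces s.2 -> uniq (corners f)].

Lemma triangle_numbered : numbered triangle.
Proof.
split=> [x|x y].
  have -> : #|` vertices triangle| = 3.
    rewrite (_ : vertices triangle = [fset x in [:: 0; 1; 2]%N]%fset).
      by rewrite card_fseq.
    by apply/fsetP => y; rewrite /= !inE; do ?[case: (_ == _)].
  by rewrite /= !inE; case: x => [|[|[|]]].
rewrite /Defs.adjacent /= !inE !fset2_eq.
by do ![case/orP]; case/andP => /eqP -> _.
Qed.

Lemma triangle_faithful : faithful (triangle, empty_region (0, 1, 2)%N).
Proof.
split; first exact: well_formed_empty_region.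
- by move=> x; rewrite /= !inE; do ?[case: (_ == _)].
- by [].
- by move=> f; rewrite /= !inE.
- by move=> f; rewrite inE => /eqP ->.
Qed.

Lemma vertices_subdivide G f :
  vertices (subdivide G f) = (#|` vertices G| |` vertices G)%fset.
Proof. by case: f => -[]. Qed.

Lemma subdivide_numbered G f : numbered G ->
  {subset corners f <= vertices G} -> numbered (subdivide G f).
Proof.
move=> [V E] fV; set v := #|` vertices G|.
have vV : v \notin vertices G by rewrite V ltnn.
have cardV : #|` vertices (subdivide G f)| = v.+1.
  by rewrite vertices_subdivide cardfsU1 vV.
split=> [x|x y]; first by rewrite cardV vertices_subdivide !inE V -/v ltnS (leq_eqVlt x).
rewrite adjacent_subdivide vertices_subdivide !inE.
case/or3P => [/E xV|/andP[/fV xV _]|/andP[xv _]]; apply/orP.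
- by right.
- by right.
- by left.
Qed.

Lemma face_corners_vertices s f : faithful s -> f \in region_faces s.2 ->
  {subset corners f <= vertices s.1}.
Proof. by move=> [wf V _ _ _] /(face_corners wf) fc x /fc; rewrite -V. Qed.

Lemma bounded_faces_subdivide G f g (v := #|` vertices G|) :
  (g \in bounded_faces (subdivide G f)) =
  (g != f) && (g \in bounded_faces G) || (g \in subfaces f v).
Proof. by case: f => -[a b] c; rewrite /= !inE -/v -!orbA. Qed.

Lemma subdivide_state_faithful s f : numbered s.1 -> faithful s ->
  f \in bounded_faces s.1 -> faithful (subdivide_state s f).
Proof.
move=> [V E] Is fB; have [wf Vr ur rB uc] := Is; set v := #|` vertices s.1|.
have fr : f \in region_faces s.2 by rewrite rB.
have vV : v \notin vertices s.1 by rewrite V ltnn.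
have vr : v \notin boundary s.2 ++ inside s.2 by rewrite -Vr.
have vc g : g \in region_faces s.2 -> v \notin corners g.
  by move=> /(face_corners_vertices Is) gV; apply: contra vV; exact: gV.
have new g : g \in subfaces f v -> v \in corners g.
  by case: (f) => -[a b] c; rewrite !inE => /or3P[]/eqP ->; rewrite !inE eqxx ?orbT.
have usub : uniq (subfaces f v) /\ forall g, g \in subfaces f v -> uniq (corners g).
  move: (vc _ fr) (uc _ fr); case: (f) => -[a b] c /=.
  rewrite !inE !negb_or !(eq_sym v) => /and3P[av bv cv] /andP[/andP[ab ac] /andP[bc _]].
  split=> [|g].
    by rewrite ?inE ?negb_or !xpair_eqE (negPf ab) (negPf ac) (negPf bc).
  have ca : c != a by rewrite eq_sym.
  by rewrite !inE => /or3P[]/eqP -> /=; rewrite !inE !negb_or ?av ?bv ?cv ?ab ?bc ?ca.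
have fp := faces_insert v ur fr.
split.
- apply: well_formed_insert => // x y /E xV.
  by apply: contraTneq xV => ->.
- move=> x; rewrite vertices_subdivide boundary_insert !inE Vr !mem_cat.
  by rewrite (perm_mem (inside_insert v ur fr)) inE orbCA.
- rewrite (perm_uniq fp) cat_uniq usub.1 rem_uniq // andbT.
  apply/hasPn => g /mem_rem gr; apply/negP => /new; exact/negP/vc.
- move=> g; rewrite (perm_mem fp) bounded_faces_subdivide mem_cat mem_rem_uniq // inE.
  by rewrite rB orbC.
- move=> g; rewrite (perm_mem fp) mem_cat => /orP[|/mem_rem]; last exact: uc.
  exact: usub.2.
Qed.

Lemma history_state fs : history fs -> numbered (state fs).1 /\ faithful (state fs).
Proof.
elim=> [|{}fs f _ [num fai] fB].
  by split; [exact: triangle_numbered|exact: triangle_faithful].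
have [_ _ _ rB _] := fai; rewrite state_rcons; split; last exact: subdivide_state_faithful.
by apply: subdivide_numbered => //; apply: (face_corners_vertices fai); rewrite rB.
Qed.

Lemma sum_shape_subdivide_state (R : realType) fs (H : block_shape -> R) : history fs ->
  \sum_(f <- region_faces (state fs).2) H (shape_of (subdivide_state (state fs) f).2) =
  \sum_(t <- grow (shape_of (state fs).2)) H t.
Proof.
move=> /history_state[_ [wf _ ur _ _]].
by rewrite -(shape_insert #|` vertices (state fs).1| wf ur) big_map.
Qed.

Lemma size_region_faces fs : history fs ->
  size (region_faces (state fs).2) = leaves (shape_of (state fs).2).
Proof.
move=> /history_state[_ [wf _ ur _ _]].
by rewrite -size_grow -(shape_insert 0 wf ur) size_map.
Qed.

Lemma leaves_history fs : history fs ->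
  leaves (shape_of (state fs).2) = (size fs).*2.+1.
Proof.
elim=> [//|{}fs f hfs IHfs fB]; have [_ [wf _ ur rB _]] := history_state hfs.
rewrite state_rcons size_rcons doubleS -IHfs; apply: leaves_grow.
rewrite -(shape_insert #|` vertices (state fs).1| wf ur).
by apply/mapP; exists f; rewrite ?rB.
Qed.

Lemma card_bounded_faces fs : history fs ->
  #|` bounded_faces (state fs).1| = (size fs).*2.+1.
Proof.
move=> hfs; rewrite -leaves_history // -size_region_faces //.
have [_ [_ _ ur rB _]] := history_state hfs.
by apply/eqP; rewrite -(uniq_size_uniq ur) ?fset_uniq.
Qed.

(** The graph after a step determines the chosen face, because that face is no
    longer a bounded face. *)
Lemma subdivide_inj fs f g : history fs ->
  f \in bounded_faces (state fs).1 -> g \in bounded_faces (state fs).1 ->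
  subdivide (state fs).1 f = subdivide (state fs).1 g -> f = g.
Proof.
move=> hfs fB gB E; apply/eqP/negPn/negP => fg.
have [num fai] := history_state hfs; have [_ _ _ rB _] := fai.
have : f \in bounded_faces (subdivide (state fs).1 g).
  by rewrite bounded_faces_subdivide fg fB.
rewrite -E bounded_faces_subdivide eqxx /=; set v := #|` _|.
have vf : v \notin corners f.
  apply/negP => /(face_corners_vertices fai); rewrite rB num.1 ltnn => /(_ fB).
  by [].
apply/negP; apply: contra vf.
case: (f) => -[a b] c; rewrite !inE => /or3P[]/eqP[]; do ?[move=> ->];
  by rewrite ?eqxx ?orbT.
Qed.

(** * From the longest path to the potential *)

Lemma simple_path_subdivide G f p :
  simple_path G p -> simple_path (subdivide G f) p.
Proof.
case/and3P => up /allP pV sp; apply/and3P; split=> //.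
  by apply/allP => x /pV xV; rewrite vertices_subdivide !inE xV orbT.
by apply: sub_sorted sp => x y xy; rewrite adjacent_subdivide xy.
Qed.

Lemma longest_path_attained G :
  exists p, simple_path G p /\ size p = longest_path G.
Proof.
pose A := [set k : 'I_#|` vertices G|.+1 |
  `[< exists p : seq nat, simple_path G p /\ size p = k >]]%SET.
have A0 : (0 < #|A|)%N.
  by apply/card_gt0P; exists ord0; rewrite inE; apply/asboolP; exists [::].
have [k kA kE] := eq_bigmax_cond (fun k : 'I_#|` vertices G|.+1 => k : nat) A0.
have : longest_path G = k.
  by rewrite -kE /longest_path; apply: eq_bigl => i; rewrite inE.
by move: kA; rewrite inE => /asboolP[p [ps pk]] ->; exists p.
Qed.

(** The extra 9 and the extra face account for the three outer vertices. *)
Lemma simple_path_sqr_le (R : realType) fs p : history fs ->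
  simple_path (state fs).1 p ->
  (size p)%:R ^+ 2 <=
    (size fs).*2.+2%:R * (9 + potential R (shape_of (state fs).2)).
Proof.
move=> hfs /and3P[up /allP pV sp]; have [_ [wf V _ _ _]] := history_state hfs.
have vis : (size p <= 3 + visits p (state fs).2)%N.
  have sz3 : size (boundary (state fs).2) = 3.
    by case: (state fs).2 => [[[[[a b] c] vs] gs]|[[[a b] c] vs] rs].
  rewrite -[X in (X + _)%N]sz3 /visits -size_filter -size_cat.
  apply: uniq_leq_size => // x xp.
  by move: (pV _ xp); rewrite V !mem_cat mem_filter /= xp.
have := visits_sqr_le R wf up sp; rewrite leaves_history // => v2.
apply: (@le_trans _ _ ((3 + visits p (state fs).2)%:R ^+ 2)).
  by rewrite ler_sqr ?nnegrE ?ler0n // ler_nat.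
have -> : (size fs).*2.+2%:R = 1 + (size fs).*2.+1%:R :> R by rewrite -nat1r.
rewrite natrD; apply: sqr_add_le => //; first exact: potential_ge0 wf.
by rewrite expr2; lra.
Qed.

(** * The law of the process *)

Definition choices (R : realType) d (Omega : measurableType d)
    (P : probability Omega R) (X : RAN_process P) (t : nat) (w : Omega) : seq face :=
  mkseq (fun i => chosen_face X i w) t.

Arguments choices : simpl never.

Lemma choicesS (R : realType) d (Omega : measurableType d)
    (P : probability Omega R) (X : RAN_process P) t w :
  choices X t.+1 w = rcons (choices X t w) (chosen_face X t w).
Proof. exact: mkseqS. Qed.

Lemma choices_history (R : realType) d (Omega : measurableType d)
    (P : probability Omega R) (X : RAN_process P) t w :
  history (choices X t w) /\ (state (choices X t w)).1 = X t w.
Proof.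
elim: t => [|t [hist stE]]; first by split; [constructor|rewrite (RAN_start X)].
rewrite choicesS state_rcons; split.
  by constructor => //; rewrite stE; exact: chosen_face_bounded.
by rewrite /= stE (RAN_step X).
Qed.

(** The conditioning on past graphs in the definition of the process is a
    conditioning on past choices. *)
Lemma choices_graphs (R : realType) d (Omega : measurableType d)
    (P : probability Omega R) (X : RAN_process P) fs w : history fs ->
  choices X (size fs) w = fs <->
  forall i, (i <= size fs)%N -> X i w = (state (take i fs)).1.
Proof.
move=> hfs; split=> [fsE i ile|].
  have <- := (choices_history X i w).2; congr (state _).1.
  rewrite -fsE /choices /mkseq -map_take take_iota; congr map; congr iota.
  by symmetry; apply/minn_idPl.
elim: hfs => {fs} [//|fs f hfs IHfs fB]; rewrite size_rcons => XE.
have fsE : choices X (size fs) w = fs.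
  apply: IHfs => i ile; rewrite XE; last exact: leqW.
  by rewrite -cats1 takel_cat.
rewrite choicesS fsE; congr rcons.
have XfsE : (state fs).1 = X (size fs) w.
  by rewrite -{1}fsE; exact: (choices_history X (size fs) w).2.
apply: (subdivide_inj hfs) => //.
  by rewrite XfsE; exact: chosen_face_bounded.
rewrite {1}XfsE -(RAN_step X) XE // -(size_rcons fs f) take_size.
by rewrite state_rcons.
Qed.

Lemma measurable_choices (R : realType) d (Omega : measurableType d)
    (P : probability Omega R) (X : RAN_process P) t (Q : set (seq face)) :
  measurable [set w | Q (choices X t w)].
Proof.
have atom fs : measurable [set w | choices X t w = fs].
  elim: t fs => [|t IHt] fs.
    by case: (pselect ([::] = fs)) => [E|nE]; [rewrite (_ : mkset _ = setT)|
      rewrite (_ : mkset _ = set0)] => //; apply/seteqP; split=> w.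
  case/lastP: fs => [|fs f].
    rewrite (_ : mkset _ = set0) //; apply/seteqP; split=> w //=.
  rewrite (_ : mkset _ = [set w | choices X t w = fs] `&`
                         [set w | chosen_face X t w = f]).
    by apply: measurableI; [exact: IHt|exact: chosen_face_measurable].
  apply/seteqP; split=> w /=; rewrite choicesS.
    by move=> /rcons_inj[-> ->].
  by move=> [-> ->].
rewrite (_ : mkset _ = \bigcup_(fs in Q) [set w | choices X t w = fs]).
  rewrite bigcup_mkcond; apply: countable_bigcupT_measurable => [|fs].
    exact: countableP.
  by case: ifP => _; [exact: atom|exact: measurable0].
apply/seteqP; split=> w /=; first by move=> Qw; exists (choices X t w).
by move=> [fs Qfs ->].
Qed.

Lemma prob_choices_rcons (R : realType) d (Omega : measurableType d)
    (P : probability Omega R) (X : RAN_process P) fs f : history fs ->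
  f \in bounded_faces (state fs).1 ->
  (P [set w | choices X (size fs).+1 w = rcons fs f] =
   ((size fs).*2.+1%:R^-1)%:E * P [set w | choices X (size fs) w = fs])%E.
Proof.
move=> hfs fB.
have pastE : [set w | choices X (size fs) w = fs] =
    [set w | forall i, (i <= size fs)%N -> X i w = (state (take i fs)).1].
  by apply/seteqP; split=> w /(choices_graphs X w hfs).
have := @chosen_face_uniform _ _ _ _ X (size fs) (fun i => (state (take i fs)).1) f.
rewrite take_size card_bounded_faces // => /(_ fB) /=; rewrite -pastE => <-; congr (P _).
apply/seteqP; split=> w /=; first by rewrite choicesS => /rcons_inj[-> ->].
by rewrite choicesS => -[-> ->].
Qed.

Lemma prob_le_sum (R : realType) d (Omega : measurableType d)
    (P : probability Omega R) (I : eqType) (s : seq I) (A : set Omega) (B : I -> set Omega) :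
  measurable A -> (forall i, measurable (B i)) ->
  (forall w, A w -> exists2 i, i \in s & B i w) ->
  fine (P A) <= \sum_(i <- s) fine (P (B i)).
Proof.
move=> mA mB AB; case: s AB => [|i0 s] AB.
  rewrite big_nil (_ : A = set0) ?measure0 //.
  by apply/seteqP; split=> // w /AB[].
rewrite (big_nth i0) big_mkord.
have PA : (P A <= \sum_(i < size (i0 :: s)) P (B (nth i0 (i0 :: s) i)))%E.
  apply: (@content_subadditive _ _ _ P A (fun k => B (nth i0 (i0 :: s) k))) => //.
  rewrite -(bigcup_mkord _ (fun k => B (nth i0 (i0 :: s) k))) => w /AB[i iS Biw].
  exists (index i (i0 :: s)); first by move: iS; rewrite -index_mem.
  by rewrite nth_index.
rewrite -lee_fin fineK ?fin_num_measure // -sumEFin.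
by under eq_bigr => i _ do rewrite fineK ?fin_num_measure //.
Qed.

(** Markov's inequality for a function of the shape at time [size fs + n], on the
    event that the process starts with [fs].  The induction on [n] conditions on
    the next face, using the one-step law and finite subadditivity. *)
Lemma tail_prob_le (R : realType) d (Omega : measurableType d)
    (P : probability Omega R) (X : RAN_process P) (F : block_shape -> R) (c : R) n fs :
  (forall fs, history fs -> 0 <= F (shape_of (state fs).2)) -> 0 < c ->
  history fs ->
  fine (P [set w | choices X (size fs) w = fs /\
                   c <= F (shape_of (state (choices X (size fs + n) w)).2)]) *
    (c * (rising (size fs).*2.+1 n)%:R) <=
  fine (P [set w | choices X (size fs) w = fs]) *
    growth_sum grow n F (shape_of (state fs).2).
Proof.
move=> F0 c0; have mC fs' n' : measurable [set w | choices X n' w = fs'].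
  exact: (measurable_choices X n' [set gs | gs = fs']).
pose Bad n' := [set w | c <= F (shape_of (state (choices X n' w)).2)].
have mBad n' : measurable (Bad n').
  exact: (measurable_choices X n' [set gs | c <= F (shape_of (state gs).2)]).
have mCB fs' n' m : measurable [set w | choices X n' w = fs' /\ Bad m w].
  exact: (measurableI _ _ (mC fs' n') (mBad m)).
have pr0 A : 0 <= fine (P A) by rewrite fine_ge0 // measure_ge0.
have pr_le A B : measurable A -> measurable B -> A `<=` B -> fine (P A) <= fine (P B).
  move=> mA mB AB; apply: fine_le; [exact: fin_num_measure|exact: fin_num_measure|].
  by apply: le_measure; rewrite ?inE.
elim: n fs => [|n IHn] fs hfs.
  rewrite addn0 mulr1 [growth_sum _ _ _ _]/=.
  case: (leP c (F (shape_of (state fs).2))) => cF.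
    apply: ler_pM => //; first exact: ltW.
    by apply: pr_le => [||w []] //; exact: mCB.
  rewrite (_ : mkset _ = set0) ?measure0 ?mul0r; last first.
    by apply/seteqP; split=> // w [->]; rewrite leNgt cF.
  by rewrite mulr_ge0 // F0.
set l := (size fs).*2.+1; set E := [set w | choices X (size fs) w = fs].
have l0 : 0 < l%:R :> R by rewrite ltr0n.
have [num [_ _ ur rB _]] := history_state hfs.
pose Bf f := [set w | choices X (size fs).+1 w = rcons fs f /\ Bad (size fs + n.+1)%N w].
apply: (@le_trans _ _ ((\sum_(f <- region_faces (state fs).2) fine (P (Bf f))) *
    (c * (rising l n.+1)%:R))).
  apply: ler_wpM2r; first by rewrite mulr_ge0 // ltW.
  apply: prob_le_sum => [||w [wfs wbad]].
  - exact: mCB.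
  - by move=> f; exact: mCB.
  - exists (chosen_face X (size fs) w); last by split=> //; rewrite choicesS wfs.
    have [_ XE] := choices_history X (size fs) w.
    by rewrite rB -[in state fs]wfs XE; exact: chosen_face_bounded.
rewrite mulr_suml [growth_sum _ _ _ _]/=.
rewrite -(sum_shape_subdivide_state (growth_sum grow n F)) // mulr_sumr.
rewrite big_seq [leRHS]big_seq; apply: ler_sum => f; rewrite rB => fB.
have hfs' := history_rcons hfs fB.
have := IHn _ hfs'; rewrite size_rcons addSnnS state_rcons.
rewrite prob_choices_rcons // fineM ?fin_num_measure // -/E -/l /= doubleS.
move=> le1; rewrite [leLHS](_ : _ =
    l%:R * (fine (P (Bf f)) * (c * (rising l.+2 n)%:R))); last by rewrite natrM; ring.
apply: le_trans (ler_wpM2l (ltW l0) le1) _.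
by rewrite !mulrA divff ?gt_eqF // mul1r.
Qed.

(** * Almost sure conclusion *)

(** The Borel-Cantelli lemma with a deadline [T j] attached to each bad event
    [B j]: outside of [B j] the event [A k] holds for suitable [k < T j].  The
    random time is the supremum of [1 + T j] over the bad events that occur, and
    1 if none occurs. *)
Lemma occurs_eventually_borel_cantelli (R : realType) d (Omega : measurableType d)
    (P : probability Omega R) (A B : nat -> set Omega) (T : nat -> nat) :
  (forall j, measurable (B j)) -> (\sum_(j <oo) P (B j) < +oo)%E ->
  (forall k, (0 < k)%N -> exists2 j, (k < T j)%N & ~` B j `<=` A k) ->
  occurs_eventually P A.
Proof.
move=> mB sumB BA.
pose u j w : \bar R := (1 + (T j)%:R * \1_(B j) w)%:E.
pose N w := esups (u ^~ w) 0%N.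
have u_le j w : (u j w <= N w)%E by apply: ereal_sup_ubound; exists j.
exists N; split.
- apply: measurable_fun_esups => j; apply/measurable_EFinP.
  apply: measurable_funD; first exact: measurable_cst.
  by apply: measurable_funM; [exact: measurable_cst|exact: measurable_indic].
- exists (lim_sup_set B); split.
  + by apply: bigcap_measurable => // n _; exact: bigcup_measurable.
  + exact: lim_sup_set_cvg0.
  + move=> w /= nfin n _; apply: contrapT => notB; apply: nfin.
    have ge1 : (1%:E <= N w)%E.
      by apply: le_trans (u_le 0%N w); rewrite lee_fin lerDl mulr_ge0.
    have leM : (N w <= (1 + \sum_(j < n) (T j)%:R)%:E)%E.
      apply: ge_ereal_sup => _ [j _ <-]; rewrite lee_fin lerD2l.
      case: (ltnP j n) => jn.
        rewrite (bigD1 (Ordinal jn)) //= ler_wpDr ?sumr_ge0 //.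
        by rewrite ler_piMr // indicE; case: (_ \in _).
      rewrite indicE memNset ?mulr0 ?sumr_ge0 // => Bjw.
      by apply: notB; exists j.
    rewrite fin_numE; apply/andP; split; apply/eqP => E; rewrite E in ge1 leM.
      by move: ge1; rewrite leeNy_eq.
    by move: leM; rewrite leye_eq.
- move=> w k Nk.
  have k0 : (0 < k)%N.
    rewrite -(ler_nat R) -lee_fin; apply: le_trans Nk.
    by apply: le_trans (u_le 0%N w); rewrite lee_fin lerDl mulr_ge0.
  have [j kT] := BA k k0; apply => Bj.
  have := le_trans (u_le j w) Nk; rewrite lee_fin indicE mem_set // mulr1.
  by rewrite nat1r ler_nat leqNgt ltnW.
Qed.

Lemma sum_geometric_lty (R : realType) (C q : R) (u : nat -> \bar R) :
  0 <= q < 1 -> (forall j, (0 <= u j)%E) -> (forall j, (u j <= (C * q ^+ j)%:E)%E) ->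
  (\sum_(j <oo) u j < +oo)%E.
Proof.
move=> /andP[q0 q1] u0 uq.
apply: (@le_lt_trans _ _ (\sum_(j <oo) (C * q ^+ j)%:E)%E); first exact: lee_nneseries.
have cv : series (geometric C q) @ \oo --> (C / (1 - q) : R^o).
  by apply: cvg_geometric_series; rewrite ger0_norm.
rewrite (@cvg_lim _ _ _ _ _ _ (C / (1 - q))%:E) ?ltry //.
have -> : (fun n => \sum_(0 <= j < n) (C * q ^+ j)%:E)%E =
          EFin \o series (geometric C q).
  by apply/funext => n; rewrite /= /series /= sumEFin.
by apply/fine_cvgP; split; [exact: nearW|exact: cv].
Qed.

(** With p the inverse of [rising 9 9], the exponent 1 - p / 18 works, since
    ln 9 <= 9 and 1 - x <= exp (- x). *)
Lemma exponent_exists (R : realType) : exists2 a : R, 0 < a < 1 &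
  9 `^ (1 - a) * (1 - 2^-1 / (rising 9 9)%:R) <= 1.
Proof.
have r1 : 1 <= (rising 9 9)%:R :> R.
  by rewrite ler1n; apply: leq_trans (rising_ge 9 9); rewrite expn_gt0.
move: (rising 9 9)%:R r1 => r r1; pose p := r^-1.
have p0 : 0 < p by rewrite invr_gt0 (lt_le_trans ltr01).
have p1 : p <= 1 by rewrite invf_le1 // (lt_le_trans ltr01).
exists (1 - p / 18); first by lra.
rewrite subKr -/p -[2^-1 / r]/(2^-1 * p).
have ln9 : ln (9 : R) <= 9.
  by have := @le_ln1Dx R 8; rewrite (_ : 1 + 8 = 9); lra.
have le1 : 9 `^ (p / 18) <= expR (2^-1 * p).
  by rewrite /powR pnatr_eq0 /= ler_expR; nra.
have le2 : 1 - 2^-1 * p <= expR (- (2^-1 * p)) by apply: expR_ge1Dx.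
apply: (@le_trans _ _ (expR (2^-1 * p) * expR (- (2^-1 * p)))).
  by rewrite ler_pM ?powR_ge0 //; lra.
by rewrite -expRD subrr expR0.
Qed.

(** The bound for the bad event at time n = 2 ^ j is of order
    n ^ (1 + a - 2 * delta), and 1 + a - 2 * delta = (a - 1) / 2 is negative. *)
Lemma tail_bound_geometric (R : realType) (a delta : R) j :
  0 < a < 1 -> delta = (3 + a) / 4 ->
  ((2 ^ j).*2.+2%:R * (14 * (2 ^ j).*2.+1%:R `^ a + 4)) /
    ((2 ^ j)%:R `^ (delta *+ 2) / 2 `^ (delta *+ 2)) <=
  960 * (2 `^ ((a - 1) / 2)) ^+ j.
Proof.
move=> /andP[a0 a1] deltaE; set n := (2 ^ j)%N; set q := 2 `^ ((a - 1) / 2).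
have n1 : (1 <= n)%N by rewrite expn_gt0.
set x : R := n%:R; have x1 : 1 <= x by rewrite ler1n.
have x0 : 0 < x by apply: lt_le_trans x1.
have y1 : 1 <= x `^ a.
  rewrite -[leLHS](_ : 1 `^ a = 1); last by rewrite powR1.
  by apply: ge0_ler_powR; rewrite ?nnegrE ?(ltW a0) ?(ltW x0).
have n2 : n.*2.+2%:R <= 4 * x.
  by rewrite /x -natrM ler_nat; lia.
have pow_le : n.*2.+1%:R `^ a <= 4 * x `^ a.
  apply: (@le_trans _ _ ((4 * x) `^ a)).
    apply: ge0_ler_powR; rewrite ?nnegrE ?(ltW a0) // ?mulr_ge0 ?(ltW x0) //.
    by rewrite /x -natrM ler_nat; lia.
  rewrite powRM ?(ltW x0) //; apply: ler_wpM2r; first exact: powR_ge0.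
  by rewrite -[leRHS]powRr1 // ler_powR ?(ltW a1) // ler1n.
have c4 : 2 `^ (delta *+ 2) <= 4 :> R.
  apply: (@le_trans _ _ (2 `^ 2%:R)); last by rewrite powR_mulrn // expr2; lra.
  by rewrite ler_powR ?ler1n // deltaE (mulr2n (_ / 4)); lra.
have qE : q ^+ j * x `^ (delta *+ 2) = x * x `^ a.
  have -> : q ^+ j = x `^ ((a - 1) / 2).
    have xE : x = 2 `^ j%:R by rewrite powR_mulrn // /x /n natrX.
    rewrite xE -(powR_mulrn j (powR_ge0 2 _)) -[LHS]powRrM -[RHS]powRrM.
    by congr (_ `^ _); exact: mulrC.
  rewrite -powRD; last by rewrite (gt_eqF x0) implybT.
  rewrite -[X in _ = X * _]powRr1 ?(ltW x0) // -powRD; last by rewrite (gt_eqF x0) implybT.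
  by congr (_ `^ _); rewrite deltaE (mulr2n (_ / 4)); lra.
rewrite invf_div mulrA ler_pdivrMr ?powR_gt0 // -[leRHS]mulrA qE.
apply: (@le_trans _ _ (240 * (x * x `^ a) * 4)); last by lra.
have N0 : 0 <= 14 * n.*2.+1%:R `^ a + 4 :> R by rewrite addr_ge0 ?mulr_ge0 ?powR_ge0.
apply: ler_pM c4; [by rewrite mulr_ge0 ?ler0n|exact: powR_ge0|].
apply: (@le_trans _ _ (4 * x * (60 * x `^ a))); last by lra.
apply: (ler_pM (ler0n _ _) N0 n2).
by move: pow_le y1; set y := _ `^ a; set z := _ `^ a => ? ?; lra.
Qed.

Theorem theorem1p2 (R : realType) :
  exists2 delta : R, delta < 1 &
    forall (d : measure_display) (Omega : measurableType d)
      (P : probability Omega R) (X : RAN_process P),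
      occurs_eventually P (fun t : nat =>
        [set w | (longest_path (X t w))%:R < t%:R `^ delta]).
Proof.
have [a a01 drift] := exponent_exists R; have /andP[a0 a1] := a01.
pose delta := (3 + a) / 4; exists delta; first by rewrite /delta; lra.
move=> d Omega P X.
pose F n (t : block_shape) : R := n.*2.+2%:R * (9 + potential R t).
(* c j = (2 ^ j / 2) ^ (2 delta): every k with 2 ^ j <= 2 k has k ^ delta at
   least the square root of c j. *)
pose c j : R := (2 ^ j)%:R `^ (delta *+ 2) / 2 `^ (delta *+ 2).
pose B j := [set w | c j <= F (2 ^ j)%N (shape_of (state (choices X (2 ^ j) w)).2)].
have mB j : measurable (B j).
  exact: (measurable_choices X (2 ^ j)
    [set fs | c j <= F (2 ^ j)%N (shape_of (state fs).2)]).
have F0 n fs : history fs -> 0 <= F n (shape_of (state fs).2).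
  move=> /history_state[_ [wf _ _ _ _]]; apply: mulr_ge0 => //.
  by rewrite addr_ge0 // (potential_ge0 R wf).
have c0 j : 0 < c j by rewrite divr_gt0 ?powR_gt0 // ltr0n expn_gt0.
have PB j : fine (P (B j)) <=
    ((2 ^ j).*2.+2%:R * (14 * (2 ^ j).*2.+1%:R `^ a + 4)) / c j.
  set n := (2 ^ j)%N; rewrite ler_pdivlMr //.
  have := tail_prob_le X n (F0 n) (c0 j) history_nil.
  have -> : [set w | choices X (size (Nil face)) w = [::] /\
      c j <= F n (shape_of (state (choices X (size (Nil face) + n) w)).2)] = B j.
    by apply/seteqP; split=> w; [case|split].
  have -> : [set w | choices X (size (Nil face)) w = [::]] = setT.
    by apply/seteqP; split.
  rewrite probability_setT /= mul1r growth_sumZ growth_sumD.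
  have := growth_sum_potential_le a01 drift n.
  rewrite -[fun=> 9]/(fun=> 9 : R).
  have -> : growth_sum grow n (fun=> 9 : R) empty_shape = 9 * (rising 1 n)%:R.
    rewrite -(growth_sum1 R n empty_shape size_grow leaves_grow) -growth_sumZ.
    by apply: growth_sum_ext => t; rewrite mulr1.
  have r0 : 0 < (rising 1 n)%:R :> R.
    by rewrite ltr0n (leq_trans _ (rising_ge 1 n)) // exp1n.
  move=> pot tail; rewrite -(ler_pM2r r0) -mulrA; apply: le_trans tail _.
  rewrite -mulrA; apply: ler_wpM2l => //; rewrite -/empty_shape; lra.
apply: (@occurs_eventually_borel_cantelli _ _ _ _ _ B (fun j => 2 ^ j)%N) => //.
  apply: (@sum_geometric_lty _ 960 (2 `^ ((a - 1) / 2))) => [|//|j].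
    rewrite powR_ge0 /= /powR pnatr_eq0 /= -[ltRHS](expR0 R) ltr_expR.
    by rewrite pmulr_llt0 ?ln_gt0 ?ltr1n //; lra.
  rewrite -(fineK (fin_num_measure P _ (mB j))) lee_fin.
  by apply: le_trans (PB j) _; exact: tail_bound_geometric.
move=> k k0; exists (trunc_log 2 k).+1; first exact: trunc_log_ltn.
set j := (trunc_log 2 k).+1 => w notB /=.
have kj : (k <= 2 ^ j)%N by exact/ltnW/trunc_log_ltn.
have jk : (2 ^ j <= k.*2)%N.
  by rewrite expnS mul2n leq_double trunc_logP.
have [p [pk <-]] := longest_path_attained (X k w).
have [hist stE] := choices_history X (2 ^ j) w.
have {}pk : simple_path (state (choices X (2 ^ j) w)).1 p.
  (* Paths of the graph at time k are still paths at time 2 ^ j. *)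
  rewrite stE -(subnKC kj); elim: (2 ^ j - k)%N => [|m IHm]; first by rewrite addn0.
  by rewrite addnS (RAN_step X); exact: simple_path_subdivide.
have := simple_path_sqr_le R hist pk; rewrite size_mkseq => p2.
have {}notB : F (2 ^ j)%N (shape_of (state (choices X (2 ^ j) w)).2) < c j.
  by rewrite ltNge; apply/negP.
rewrite -ltr_sqr ?nnegrE ?powR_ge0 //.
apply: le_lt_trans p2 (lt_le_trans notB _).
rewrite /c -powR_mulrn ?powR_ge0 // -powRrM mulr_natr.
rewrite ler_pdivrMr ?powR_gt0 // -powRM //.
apply: ge0_ler_powR; rewrite ?nnegrE ?mulr_ge0 //.
  by rewrite /delta mulrn_wge0 // divr_ge0 // addr_ge0 // ltW.
by rewrite -natrM ler_nat muln2.
Qed.
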